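(* Let $\lambda>0$ and let $\{c_k\}_{k\ge1}$ be i.i.d. random variables whose common distribution is absolutely continuous on $[0,1]$ with a density that is uniformly bounded and positive almost everywhere on $[0,1]$. Let $l_k=e^{-\lambda k}$, let $I_k$ be the open interval of length $l_k$ centered at $c_k$, and let $S=\bigcap_{m\ge1}\bigcup_{k\ge m} I_k$. Then, almost surely, $\mathrm{Cap}(S)=\mathrm{Cap}([0,1])>0$.
   Context: For finite Borel measures $\mu,\nu$ on $\mathbb{C}$, the interaction is $I(\nu,\mu)=\iint(-\log|z-w|)\,d\nu(z)\,d\mu(w)$ and the energy is $I(\mu)=I(\mu,\mu)$. The logarithmic capacity of $E\subset\mathbb{C}$ is $\mathrm{Cap}(E)=\exp(-\inf I(\mu))$, the infimum over Borel probability measures $\mu$ whose support is a compact subset of $E$ (with $e^{-\infty}=0$). One has $\mathrm{Cap}([0,1])=1/4$. *)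

(* Defs.v *)
From HB Require Import structures.
From mathcomp Require Import all_boot all_order all_algebra.
From mathcomp Require Import all_classical all_reals all_analysis.
Set Implicit Arguments. Unset Strict Implicit. Unset Printing Implicit Defensive.
Import Order.TTheory GRing.Theory Num.Theory.
Import numFieldNormedType.Exports.
Local Open Scope classical_set_scope.
Local Open Scope ring_scope.

(* The complex plane is modelled as R * R (z = (Re z, Im z)) with the
   product sigma-algebra (= Borel sigma-algebra of R^2). *)

Definition cdist (R : realType) (z w : R * R) : R :=
  Num.sqrt ((z.1 - w.1) ^+ 2 + (z.2 - w.2) ^+ 2).

Definition logkernel (R : realType) (z w : R * R) : \bar R :=
  if z == w then +oo%E else (- ln (cdist z w))%:E.

Definition interaction (R : realType) (nu mu : probability (R * R)%type R) : \bar R :=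
  (\int[nu]_z \int[mu]_w logkernel z w)%E.

Definition energy (R : realType) (mu : probability (R * R)%type R) : \bar R :=
  interaction mu mu.

(* Support of a measure: points all of whose neighbourhoods (balls) have
   positive measure; this is the smallest closed set of full measure. *)
Definition msupport (R : realType) (mu : probability (R * R)%type R) : set (R * R) :=
  [set z | forall e : R, 0 < e -> (0 < mu (ball z e))%E].

Definition admissible (R : realType) (E : set (R * R)) :
    set (probability (R * R)%type R) :=
  [set mu | compact (msupport mu) /\ msupport mu `<=` E].

(* Logarithmic capacity Cap(E) = exp(- inf I(mu)), with exp(-oo) = 0. *)
Definition Cap (R : realType) (E : set (R * R)) : \bar R :=
  expeR (- ereal_inf [set energy mu | mu in admissible E])%E.

Definition real_axis (R : realType) (A : set R) : set (R * R) :=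
  [set z | z.2 = 0 /\ A z.1].

Definition mutually_independent (d : measure_display) (Omega : measurableType d)
    (R : realType) (P : probability Omega R) (X : nat -> Omega -> R) : Prop :=
  forall (s : seq nat) (B : nat -> set R),
    uniq s -> (forall i, i \in s -> measurable (B i)) ->
    P (\big[setI/setT]_(i <- s) (X i @^-1` B i)) =
    (\prod_(i <- s) P (X i @^-1` B i))%E.

(* The random limsup set S = \bigcap_m \bigcup_{k >= m} I_k, where
   (re-indexing k |-> k+1) c k stands for c_{k+1} and I_{k+1} is the open
   interval of length exp(-lambda (k+1)) centred at c_{k+1}. *)
Definition limsup_set (R : realType) (lambda : R) (c : nat -> R) : set R :=
  [set x | forall m : nat, exists2 k : nat, (m <= k)%N &
     `|x - c k| < expR (- (lambda * k.+1%:R)) / 2].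

(* Main.v *)
(* Distribute a measure on [0,1] along the binary tree of dyadic intervals: a
   flow assigns to every interval the sum of the masses of its two halves, and
   its logarithmic energy is controlled by the sum of the squares of all masses.
   Tree energy is local: refining a flow inside each interval of a level changes
   it by the square of the mass of that interval times a relative energy.

   Almost surely, for every dyadic D there is L such that for infinitely many N
   nearly all of the 2^N subintervals of D of relative level N contain one of
   the centres c_k, 2^N <= k < (L+1) 2^N.  Spreading mass evenly over these
   subintervals, and within each of them over a tiny dyadic interval covered by
   I_k, gives flows on D of bounded energy, since the extra levels, of order
   lambda L 2^N, carry squared masses 4^-N in each of 2^N subintervals.
   Averages of such flows over fast growing N have energy close to that of the
   uniform flow, so a flow can be pushed into the sets covered by late I_k at an
   arbitrarily small cost.  Iterating gives a measure on S with the masses of a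
   prescribed mu on the cells of level m.  Placing these masses at distance from
   the cell boundaries, its energy exceeds that of mu by at most a small constant
   plus a multiple of (mu x mu)(|x - y| < M 2^-m), which tends to 0 as m grows
   when mu has finite energy. *)
Require Import Defs.
From HB Require Import structures.
From mathcomp Require Import all_boot all_order all_algebra.
From mathcomp Require Import all_classical all_reals all_analysis measurable_realfun.
From mathcomp Require Import ring lra zify.
Import Order.TTheory GRing.Theory Num.Theory.
Import numFieldNormedType.Exports.
Local Open Scope classical_set_scope.
Local Open Scope ring_scope.
Set Implicit Arguments.
Unset Strict Implicit.

(** * Flows on the dyadic tree *)

(** [v n i] is the mass of the [i]-th dyadic interval of level [n]. All natural indices are allowed;
    the condition at the root forces mass zero outside [[0, 1)] (see [flow_out]). *)
Definition flow {R : realType} (v : nat -> nat -> R) : Prop :=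
  [/\ forall n i, 0 <= v n i,
      forall n i, v n i = v n.+1 i.*2 + v n.+1 i.*2.+1
    & forall i, v 0%N i = (i == 0%N)%:R].

Definition uniform_below {R : realType} (t : nat) (v : nat -> nat -> R) : Prop :=
  forall n, (t <= n)%N -> forall i, v n.+1 i = v n i./2 / 2.

Definition level_dot {R : realType} (n : nat) (u v : nat -> nat -> R) : R :=
  \sum_(0 <= i < 2 ^ n) u n i * v n i.

(* For flows uniform below level [t], the last term is the geometric tail
   [\sum_(n >= t) level_dot n u v]. *)
Definition tree_energy {R : realType} (m t : nat) (u v : nat -> nat -> R) : R :=
  \sum_(m <= n < t) level_dot n u v + 2 * level_dot t u v.

Section Flow.
Variable R : realType.
Implicit Types u v : nat -> nat -> R.

Lemma sum_nat_double (g : nat -> R) k :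
  \sum_(0 <= i < k.*2) g i = \sum_(0 <= i < k) (g i.*2 + g i.*2.+1).
Proof.
elim: k => [|k IH]; first by rewrite !big_geq.
by rewrite doubleS !big_nat_recr//= IH addrA.
Qed.

Lemma sum_pow2S (g : nat -> R) n :
  \sum_(0 <= i < 2 ^ n.+1) g i = \sum_(0 <= i < 2 ^ n) (g i.*2 + g i.*2.+1).
Proof. by rewrite expnS mul2n sum_nat_double. Qed.

Lemma flow_ge0 v n i : flow v -> 0 <= v n i.
Proof. by case. Qed.

Lemma flow_split v n i : flow v -> v n i = v n.+1 i.*2 + v n.+1 i.*2.+1.
Proof. by case. Qed.

Lemma flow_le v n i : flow v -> v n.+1 i <= v n i./2.
Proof.
case=> v0 vS _; rewrite (vS n) -{1}(odd_double_half i).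
by case: (odd i); rewrite ?add1n ?add0n ?lerDl ?lerDr.
Qed.

Lemma flow_out v n i : flow v -> (2 ^ n <= i)%N -> v n i = 0.
Proof.
move=> fv; elim: n i => [|n IH] i hi.
  by case: fv => _ _ ->; case: i hi => [|i]; rewrite ?expn0.
apply/eqP; rewrite eq_le flow_ge0// andbT (le_trans (flow_le n i fv))// IH//.
by rewrite expnS in hi; lia.
Qed.

Lemma flow_mass v n : flow v -> \sum_(0 <= i < 2 ^ n) v n i = 1.
Proof.
move=> fv; elim: n => [|n IH].
  by rewrite expn0 big_nat1; case: fv => _ _ ->.
by rewrite sum_pow2S -IH; apply: eq_bigr => i _; rewrite -flow_split.
Qed.

Lemma flow_eq_coarse u v n k : flow u -> flow v -> (forall i, u n i = v n i) ->
  (k <= n)%N -> forall i, u k i = v k i.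
Proof.
move=> fu fv; elim: n k => [|n IH] k uv; first by rewrite leqn0 => /eqP ->.
rewrite leq_eqVlt => /orP[/eqP ->//|kn]; apply: IH => // i.
by rewrite (flow_split n _ fu) (flow_split n _ fv) !uv.
Qed.

Lemma uniform_belowW t t' v : (t <= t')%N -> uniform_below t v -> uniform_below t' v.
Proof. by move=> tt' h n t'n; apply: h; exact: leq_trans t'n. Qed.

Lemma level_dot_ge0 n u v : flow u -> flow v -> 0 <= level_dot n u v.
Proof. by move=> fu fv; apply: sumr_ge0 => i _; rewrite mulr_ge0// flow_ge0. Qed.

(** Even splitting of [u] alone suffices: the two halves of [v] are weighted equally and add up to
    the mass of their parent. *)
Lemma level_dotS_uniform n t u v : uniform_below t u -> flow v -> (t <= n)%N ->
  level_dot n.+1 u v = level_dot n u v / 2.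
Proof.
move=> hu fv tn; rewrite /level_dot sum_pow2S mulr_suml; apply: eq_bigr => i _.
by rewrite !hu// doubleK -[i.*2.+1]add1n (half_bit_double i true) (flow_split n _ fv)//; field.
Qed.

Lemma tree_energy_uniform m t t' u v : uniform_below t u -> flow v ->
  (m <= t)%N -> (t <= t')%N -> tree_energy m t' u v = tree_energy m t u v.
Proof.
move=> hu fv mt /subnK <-; elim: (t' - t)%N => // d <-; rewrite addSn /tree_energy.
rewrite big_nat_recr/=; last by rewrite (leq_trans mt)// leq_addl.
by rewrite (level_dotS_uniform hu fv)// ?leq_addl//; field.
Qed.

Lemma tree_energy_geometric m t u v (G : R) : 0 <= G -> (m <= t)%N ->
  (forall n, (m <= n <= t)%N -> level_dot n u v <= G / 2 ^+ (n - m)) ->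
  tree_energy m t u v <= 2 * G.
Proof.
move=> G0 mt h.
(* The tail term compensates exactly for the levels cut off, so the bound does not depend on where
   the sum stops. *)
have E d : \sum_(m <= n < m + d) G / 2 ^+ (n - m) + 2 * (G / 2 ^+ d) = 2 * G.
  elim: d => [|d IH]; first by rewrite addn0 big_geq// expr0; field.
  rewrite addnS big_nat_recr/= ?leq_addr// addKn exprS -[RHS]IH.
  by field; rewrite expf_neq0.
rewrite -(E (t - m)%N) subnKC// lerD//.
  by apply: ler_sum_nat => n /andP[mn nt]; rewrite h// mn ltnW.
by rewrite ler_pM2l// h// mt leqnn.
Qed.

(** Below [N] the even splitting of [u] averages [v] out, so only the nearly uniform levels up to
    [N] matter, however concentrated [v] becomes further down. This is what makes averaging
    effective. *)
Lemma tree_energy_cross m N t u v (G : R) : 0 <= G -> flow u -> flow v ->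
  (m <= N)%N -> (N <= t)%N -> uniform_below N u ->
  (forall n i, (m <= n <= N)%N -> v n i <= G / 2 ^+ (n - m)) ->
  tree_energy m t u v <= 2 * G.
Proof.
move=> G0 fu fv mN Nt hu hv.
have hd n : (m <= n <= N)%N -> level_dot n u v <= G / 2 ^+ (n - m).
  move=> hn; rewrite -[leRHS]mul1r -[X in X * _](flow_mass n fu) mulr_suml.
  by apply: ler_sum => i _; apply: ler_wpM2l; [exact: flow_ge0|exact: hv].
rewrite (tree_energy_uniform hu)//.
exact: tree_energy_geometric.
Qed.

Lemma level_dot_nonincr v n n' : flow v -> (n <= n')%N ->
  level_dot n' v v <= level_dot n v v.
Proof.
move=> fv /subnK <-; elim: (n' - n)%N => // d; apply: le_trans.
rewrite addSn /level_dot sum_pow2S; apply: ler_sum => i _.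
rewrite (flow_split (d + n) i fv).
have := flow_ge0 (d + n).+1 i.*2 fv; have := flow_ge0 (d + n).+1 i.*2.+1 fv.
by nra.
Qed.

(** Sums of squared masses do not increase with the level, so every level past [N] costs at most
    [G / 2^(N-m)]. A number of extra levels of order [2^(N-m)] is therefore affordable. *)
Lemma tree_energy_self m N t v (G : R) : 0 <= G -> flow v ->
  (m <= N)%N -> (N <= t)%N ->
  (forall n i, (m <= n <= N)%N -> v n i <= G / 2 ^+ (n - m)) ->
  tree_energy m t v v <= 2 * G + G * (t - N + 2)%:R / 2 ^+ (N - m).
Proof.
move=> G0 fv mN Nt hv.
have hd n : (m <= n <= N)%N -> level_dot n v v <= G / 2 ^+ (n - m).
  move=> hn; rewrite -[leRHS]mul1r -[X in X * _](flow_mass n fv) mulr_suml.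
  by apply: ler_sum => i _; apply: ler_wpM2l; [exact: flow_ge0|exact: hv].
have hN : level_dot N v v <= G / 2 ^+ (N - m) by apply: hd; rewrite mN leqnn.
have := tree_energy_geometric G0 mN hd; rewrite /tree_energy => hm.
rewrite (big_cat_nat mN Nt)/=.
have h1 : \sum_(N <= n < t) level_dot n v v <= (t - N)%:R * (G / 2 ^+ (N - m)).
  have -> : (t - N)%:R * (G / 2 ^+ (N - m)) = \sum_(N <= n < t) (G / 2 ^+ (N - m)).
    by rewrite sumr_const_nat mulr_natl.
  by apply: ler_sum_nat => n /andP[Nn _]; rewrite (le_trans (level_dot_nonincr fv Nn)).
have h2 := le_trans (level_dot_nonincr fv Nt) hN.
have h3 := level_dot_ge0 N fv fv.
have -> : G * (t - N + 2)%:R / 2 ^+ (N - m) =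
          (t - N)%:R * (G / 2 ^+ (N - m)) + 2 * (G / 2 ^+ (N - m)).
  by rewrite natrD; field; rewrite expf_neq0.
move: h1 h2 hm hN; set g := G / _.
lra.
Qed.

End Flow.

(** The masses of the uniform law on the [r]-th dyadic interval of level [t]: its ancestors carry
    mass one, its descendants equal shares. *)
Definition unit_flow {R : realType} (t r n i : nat) : R :=
  if (n <= t)%N then (r %/ 2 ^ (t - n) == i)%N%:R
  else (i %/ 2 ^ (n - t) == r)%N%:R / 2 ^+ (n - t).

Definition dyadic {R : realType} (n b : nat) : set R :=
  [set x | b%:R <= 2 ^+ n * x < b%:R + 1].

(** Closed cells appear because the point determined by a nested sequence of cells can be a right
    endpoint. *)
Definition cdyadic {R : realType} (n b : nat) : set R :=
  [set x | b%:R <= 2 ^+ n * x <= b%:R + 1].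

Definition charges_in {R : realType} (t : nat) (v : nat -> nat -> R) (U : set R) :=
  forall b, v t b != 0 -> cdyadic t b `<=` U.

Definition tail_cover {R : realType} (lambda : R) (c : nat -> R) (k0 : nat) : set R :=
  [set x | exists2 k, (k0 <= k)%N & `|x - c k| < expR (- (lambda * k.+1%:R)) / 2].

Definition hit {R : realType} (c : nat -> R) (n b k0 k1 : nat) : Prop :=
  exists2 k, (k0 <= k < k1)%N & dyadic n b (c k).

(** The window gives each of the [2^N] subintervals about [L] trials. Its lower end makes the
    intervals [I_k] late, its upper end keeps them from being too short. *)
Definition missed {R : realType} (c : nat -> R) (m a N L : nat) : nat :=
  \sum_(0 <= j < 2 ^ N) ~~ `[< hit c (m + N) (a * 2 ^ N + j) (2 ^ N) (L.+1 * 2 ^ N) >].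

(** A missed fraction of at most [1/(p+2)] means that mass shared evenly among the hit cells exceeds
    uniform mass at most by the factor [1 + 1/(p+1)]. [L] is fixed before [n], which makes the
    energy bound of [hit_flow] independent of the scale. *)
Definition well_spread {R : realType} (c : nat -> R) : Prop :=
  forall m a p, (a < 2 ^ m)%N -> exists L, forall n, exists2 N, (n <= N)%N &
    (missed c m a N L * p.+2 <= 2 ^ N)%N.

(** * Convex combinations of flows and arithmetic of dyadic intervals *)

Section Combination.
Variable R : realType.
Implicit Types u v : nat -> nat -> R.

Lemma flow_comb (s : seq nat) (w : nat -> R) (th : nat -> nat -> nat -> R) :
  (forall j, 0 <= w j) -> (forall j, j \in s -> flow (th j)) ->
  \sum_(j <- s) w j = 1 -> flow (fun n i => \sum_(j <- s) w j * th j n i).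
Proof.
move=> w0 hth w1; split=> [n i|n i|i].
- rewrite big_seq; apply: sumr_ge0 => j js; rewrite mulr_ge0//.
  by apply: flow_ge0; exact: hth.
- rewrite -big_split/= big_seq [RHS]big_seq; apply: eq_bigr => j js.
  by rewrite (flow_split n i (hth _ js)) mulrDr.
- rewrite -[RHS]mul1r -[X in X * _]w1 mulr_suml big_seq [RHS]big_seq.
  by apply: eq_bigr => j /hth [_ _ ->].
Qed.

Lemma uniform_below_comb t (s : seq nat) (w : nat -> R) (th : nat -> nat -> nat -> R) :
  (forall j, j \in s -> uniform_below t (th j)) ->
  uniform_below t (fun n i => \sum_(j <- s) w j * th j n i).
Proof.
move=> h n tn i; rewrite mulr_suml big_seq [RHS]big_seq.
by apply: eq_bigr => j /h -> //; rewrite mulrA.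
Qed.

Lemma unit_flow_uniform t r : uniform_below t (unit_flow t r : _ -> _ -> R).
Proof.
move=> n tn i; rewrite /unit_flow ltnNge tn/= subSn// expnS -divn2 divnMA.
case: ifPn => nt; last by rewrite exprS; field; rewrite expf_neq0.
have -> : n = t by apply/eqP; rewrite eqn_leq tn nt.
by rewrite subnn !expn0 !divn1 expr1 eq_sym.
Qed.

Lemma unit_flow_flow t r : (r < 2 ^ t)%N -> flow (unit_flow t r : _ -> _ -> R).
Proof.
move=> rt; split=> [n i|n i|i].
- by rewrite /unit_flow; case: ifP => // _; rewrite divr_ge0// exprn_ge0.
- case: (ltnP n t) => nt; last first.
    rewrite !(unit_flow_uniform r nt) doubleK -[i.*2.+1]add1n.
    by rewrite (half_bit_double i true); field.
  rewrite /unit_flow nt (ltnW nt) -natrD; congr (_%:R).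
  have -> : (t - n = (t - n.+1).+1)%N by rewrite subnSK.
  rewrite expnSr divnMA; set q := (r %/ _)%N; lia.
- by rewrite /unit_flow leq0n subn0 divn_small//= [in RHS]eq_sym.
Qed.

Lemma flow_coarse_le v (X : R) n N : flow v -> (forall i, v N i <= X) ->
  (n <= N)%N -> forall i, v n i <= X * 2 ^+ (N - n).
Proof.
move=> fv hX /subnKC; move: (N - n)%N => d; elim: d n => [|d IH] n hn i.
  by rewrite expr0 mulr1 -[n]addn0 hn.
rewrite (flow_split n i fv) exprS.
have hd : (n.+1 + d = N)%N by rewrite addSnnS.
by have := IH _ hd i.*2; have := IH _ hd i.*2.+1; lra.
Qed.

Lemma dyadic_trunc n s b (x : R) : dyadic n b x ->
  (Num.truncn (2 ^+ (n + s) * x) %/ 2 ^ s = b)%N.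
Proof.
rewrite /dyadic/= => /andP[bx xb].
have s0 : (0 : R) < 2 ^+ s by rewrite exprn_gt0.
have y0 : 0 <= 2 ^+ (n + s) * x.
  by rewrite exprD mulrAC mulr_ge0 ?(ltW s0)// (le_trans _ bx).
apply/eqP; rewrite eqn_leq -ltnS ltn_divLR ?expn_gt0// leq_divRL ?expn_gt0//.
rewrite truncn_lt_nat// truncn_ge_nat// !natrM natrX exprD mulrAC.
by rewrite !(ltr_pM2r s0, ler_pM2r s0) bx -(natr1 b) xb.
Qed.

Lemma dyadic_in_truncn n (x : R) : 0 <= x -> dyadic n (Num.truncn (2 ^+ n * x)) x.
Proof.
move=> x0; rewrite /dyadic/=.
have := @truncn_itv R (2 ^+ n * x); rewrite natr1; apply.
by rewrite mulr_ge0// exprn_ge0.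
Qed.

Lemma dyadic_ge0 n b (x : R) : dyadic n b x -> 0 <= x.
Proof.
rewrite /dyadic/= => /andP[bx _].
by rewrite -(@pmulr_rge0 _ (2 ^+ n)) ?exprn_gt0// (le_trans _ bx)// ler0n.
Qed.

Lemma missed_hits (c : nat -> R) m a N L :
  (size [seq j <- iota 0 (2 ^ N) |
    `[< hit c (m + N) (a * 2 ^ N + j) (2 ^ N) (L.+1 * 2 ^ N) >]]
   + missed c m a N L = 2 ^ N)%N.
Proof.
rewrite /missed size_filter -sum1_count big_mkcond /= /index_iota subn0 -big_split/=.
rewrite -[RHS](size_iota 0) -sum1_size; apply: eq_bigr => j _.
by case: ifP.
Qed.

Lemma cdyadic_dist n b (x y : R) : cdyadic n b x -> cdyadic n b y ->
  2 ^+ n * `|x - y| <= 1.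
Proof.
rewrite /cdyadic/= => /andP[h1 h2] /andP[h3 h4].
rewrite -[X in X * _](@ger0_norm _ (2 ^+ n)) ?exprn_ge0// -normrM mulrBr ler_norml.
by apply/andP; split; lra.
Qed.

Lemma dyadicW n b : (dyadic n b : set R) `<=` cdyadic n b.
Proof. by move=> x; rewrite /dyadic/cdyadic/= => /andP[-> /ltW ->]. Qed.

End Combination.

(** * Refining a flow into the covered set *)

Section Refine.
Variable R : realType.
Implicit Types u v : nat -> nat -> R.
Variables (lambda : R) (c : nat -> R).
Hypothesis lambda_gt0 : 0 < lambda.

(** The cell has length [2^-t], which is less than [exp(-lambda (k+1)) / 2] because
    [exp(lambda) <= 2^C]; so [I_k] contains every closed cell of that level around its centre. *)
Lemma cdyadic_tail_cover k k0 t b (C : nat) : lambda <= C%:R * ln 2 -> (k0 <= k)%N ->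
  (C * k.+1 + 2 <= t)%N -> dyadic t b (c k) -> cdyadic t b `<=` tail_cover lambda c k0.
Proof.
move=> hC k0k ht /dyadicW hc x hx; exists k => //.
have := cdyadic_dist hx hc; rewrite mulrC -ler_pdivlMr ?exprn_gt0// mul1r => h.
apply: (le_lt_trans h); rewrite expRN ltr_pdivlMr//.
have hb : expR (lambda * k.+1%:R) <= 2 ^+ (C * k.+1).
  rewrite -[X in X ^+ _](@lnK R) ?posrE// -expRM_natl ler_expR natrM mulrAC.
  by rewrite ler_pM2r// ltr0n.
have e0 := expR_gt0 (lambda * k.+1%:R).
rewrite mulrC ltr_pdivrMr ?exprn_gt0// ltr_pdivlMl// mulrC.
apply: (@le_lt_trans _ _ (2 * 2 ^+ (C * k.+1))); first by rewrite ler_pM2l.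
by rewrite -exprS ltr_eXn2l ?ltr1n//; lia.
Qed.

(** [B] comes before the scale: about [C (L+1) 2^N'] levels are added below [N = m + N'], each at a
    cost of order [2^-N']. *)
Lemma hit_flow m a p : well_spread c -> (a < 2 ^ m)%N ->
  exists B : R, forall k0 n0, exists N t v,
  [/\ (n0 <= N)%N, (m <= N)%N & (N <= t)%N] /\
  [/\ flow v, forall i, v m i = (i == a)%:R & uniform_below t v] /\
  [/\ forall n i, (m <= n <= N)%N -> v n i <= (1 + p.+1%:R^-1) / 2 ^+ (n - m),
      charges_in t v (tail_cover lambda c k0) & tree_energy m t v v <= B].
Proof.
move=> spread am.
have [L hL] := spread m a p am.
have ln2 : (0 : R) < ln 2 by rewrite ln_gt0// ltr1n.
pose C := (Num.truncn (lambda / ln 2)).+1.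
have hC : lambda <= C%:R * ln 2.
  by rewrite -ler_pdivrMr// ltW// /C truncnS_gt.
pose G : R := 1 + p.+1%:R^-1.
have G0 : 0 <= G by rewrite addr_ge0// invr_ge0.
(* The factor [4 + C (L+1)] bounds [(t - N + 2) / 2^N'] for the [t] chosen below. *)
exists (2 * G + G * (4 + C * L.+1)%:R) => k0 n0.
have [N' hN' hmiss] := hL (maxn n0 k0).
(* Every [k] of the window satisfies [k + 1 <= (L+1) 2^N'], so [t] meets the depth requirement of
   [cdyadic_tail_cover] for all of them at once. *)
pose N := (m + N')%N; pose t := (N + (2 + C * (L.+1 * 2 ^ N')))%N.
have N'pow : (N' < 2 ^ N')%N by rewrite ltn_expl.
set ishit := (fun j => hit c (m + N') (a * 2 ^ N' + j) (2 ^ N') (L.+1 * 2 ^ N')) in hmiss.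
pose H := [seq j <- iota 0 (2 ^ N') | `[< ishit j >]].
have sizeH : (size H + missed c m a N' L = 2 ^ N')%N by exact: missed_hits.
have H0 : (0 < size H)%N.
  rewrite lt0n; apply/eqP => h; move: sizeH hmiss; rewrite h add0n => ->.
  by have := expn_gt0 2 N'; nia.
have uniqH : uniq H by rewrite filter_uniq// iota_uniq.
have Hlt j : j \in H -> (j < 2 ^ N')%N.
  by rewrite mem_filter mem_iota add0n => /andP[_ /andP[_ ->]].
have hkex j : exists k, j \in H -> (2 ^ N' <= k < L.+1 * 2 ^ N')%N /\
    dyadic N (a * 2 ^ N' + j) (c k).
  case: (boolP (j \in H)) => jH; last by exists 0%N.
  have := jH; rewrite mem_filter => /andP[/asboolP [k hk hd] _].
  by exists k.
pose kk j := projT1 (cid (hkex j)).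
have hkk j : j \in H -> (2 ^ N' <= kk j < L.+1 * 2 ^ N')%N /\
    dyadic N (a * 2 ^ N' + j) (c (kk j)) by exact: (projT2 (cid (hkex j))).
(* The whole share of the hit cell [j] goes to the tiny cell of level [t] around one chosen
   centre. *)
pose r j := Num.truncn (2 ^+ t * c (kk j)).
have hr j : j \in H -> (r j %/ 2 ^ (t - N) = a * 2 ^ N' + j)%N.
  move=> /hkk [_ hd]; rewrite /r /t addKn; exact: dyadic_trunc.
have hrm j : j \in H -> (r j %/ 2 ^ (t - m) = a)%N.
  move=> jH; have -> : (t - m = (t - N) + N')%N by rewrite /t /N; lia.
  by rewrite expnD divnMA hr// divnMDl ?expn_gt0// divn_small ?addn0// Hlt.
have hrt j : j \in H -> (r j < 2 ^ t)%N.
  move=> jH; have -> : (t = (t - m) + m)%N by rewrite /t /N; lia.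
  by rewrite expnD mulnC -ltn_divLR ?expn_gt0// hrm.
pose w (j : nat) : R := (size H)%:R^-1.
have sH : (0 : R) < (size H)%:R by rewrite ltr0n.
have w1 : \sum_(j <- H) w j = 1.
  by rewrite /w big_const_seq count_predT iter_addr_0 -[LHS]mulr_natl divff// gt_eqF.
pose v n i := \sum_(j <- H) w j * unit_flow t (r j) n i.
have fv : flow v.
  apply: flow_comb => // [j|j jH]; first by rewrite /w invr_ge0 ltW.
  by apply: unit_flow_flow; exact: hrt.
have mN : (m <= N)%N by rewrite /N leq_addr.
have Nt : (N <= t)%N by rewrite /t leq_addr.
(* Different hits lie in different cells of level [N], so no such cell receives more than one
   share. *)
have vN i : v N i <= (size H)%:R^-1.
  rewrite /v big_seq; under eq_bigr => j jH do rewrite /unit_flow Nt hr// /w.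
  rewrite -big_seq -mulr_sumr ler_piMr ?invr_ge0// -natr_sum.
  rewrite -[leRHS]/(1%:R) ler_nat.
  case: (boolP ((a * 2 ^ N' <= i)%N)) => hai; last first.
    by rewrite big1// => j _; apply/eqP; rewrite eqb0; lia.
  rewrite (eq_bigr (fun j => nat_of_bool (j == (i - a * 2 ^ N')%N))); last first.
    by move=> j _; congr nat_of_bool; lia.
  have -> x : (\sum_(j <- H) (j == x) = count_mem x H)%N.
    by rewrite -sum1_count [RHS]big_mkcond.
  by rewrite count_uniq_mem// leq_b1.
have hv n i : (m <= n <= N)%N -> v n i <= G / 2 ^+ (n - m).
  move=> /andP[mn nN].
  apply: (le_trans (flow_coarse_le fv vN nN i)).
  rewrite ler_pdivlMr ?exprn_gt0// -mulrA -exprD.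
  have -> : (N - n + (n - m) = N')%N by rewrite /N; lia.
  rewrite mulrC ler_pdivrMr// /G -(@ler_pM2r _ p.+1%:R) ?ltr0n//.
  have -> : (1 + p.+1%:R^-1) * (size H)%:R * p.+1%:R = (p.+2 * size H)%:R :> R.
    rewrite natrM -[p.+2%:R]natr1; have : p.+1%:R != 0 :> R by rewrite pnatr_eq0.
    by move: (p.+1%:R : R) => q q0; field.
  rewrite -natrX -natrM ler_nat.
  by move: sizeH hmiss; nia.
exists N, t, v; split; first by split => //; rewrite /N; lia.
split.
  split => //.
    move=> i; rewrite /v big_seq.
    under eq_bigr => j jH do
      rewrite /unit_flow (leq_trans mN Nt) hrm// [_ == _]eq_sym.
    by rewrite -big_seq -mulr_suml w1 mul1r.
  by apply: uniform_below_comb => j _; exact: unit_flow_uniform.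
split => //.
  move=> b vb.
  have [j jH jb] : exists2 j, j \in H & r j = b.
    apply: contrapT => hn; move/eqP: vb; apply.
    rewrite /v big_seq big1// => j jH.
    rewrite /unit_flow leqnn subnn expn0 divn1; case: eqP => [e|_]; last by rewrite mulr0.
    by exfalso; apply: hn; exists j.
  have [/andP[h1 h2] hd] := hkk _ jH.
  apply: (@cdyadic_tail_cover (kk j) _ _ _ C) => //.
  - by rewrite (leq_trans _ h1)// (leq_trans _ (ltnW N'pow))//; lia.
  - by rewrite /t; nia.
  - by rewrite -jb; apply: dyadic_in_truncn; exact: dyadic_ge0 hd.
apply: (le_trans (tree_energy_self G0 fv mN Nt hv)).
rewrite lerD2l -mulrA ler_wpM2l// ler_pdivrMr ?exprn_gt0// -natrX -natrM ler_nat.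
by rewrite /t /N !addKn; nia.
Qed.

End Refine.

(** * Averaging flows, local refinement and passage to the limit *)

Section Mix.
Variable R : realType.
Implicit Types u v : nat -> nat -> R.

Definition mix (a : R) u v (n i : nat) : R := (1 - a) * u n i + a * v n i.

Lemma mix_flow a u v : 0 <= a <= 1 -> flow u -> flow v -> flow (mix a u v).
Proof.
move=> /andP[a0 a1] fu fv; split=> [n i|n i|i]; rewrite /mix.
- by rewrite addr_ge0// mulr_ge0 ?subr_ge0// flow_ge0.
- by rewrite (flow_split n i fu) (flow_split n i fv); ring.
- by case: fu => _ _ ->; case: fv => _ _ ->; ring.
Qed.

Lemma mix_uniform a u v t : uniform_below t u -> uniform_below t v ->
  uniform_below t (mix a u v).
Proof. by move=> hu hv n tn i; rewrite /mix hu// hv//; field. Qed.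

Lemma tree_energy_mix a u v m t : tree_energy m t (mix a u v) (mix a u v) =
  (1 - a) ^+ 2 * tree_energy m t u u + 2 * a * (1 - a) * tree_energy m t u v
  + a ^+ 2 * tree_energy m t v v.
Proof.
have E n : level_dot n (mix a u v) (mix a u v) = (1 - a) ^+ 2 * level_dot n u u
    + 2 * a * (1 - a) * level_dot n u v + a ^+ 2 * level_dot n v v.
  rewrite /level_dot !mulr_sumr -!big_split/=; apply: eq_bigr => i _.
  by rewrite /mix; ring.
rewrite /tree_energy E; under eq_bigr do rewrite E.
by rewrite !big_split/= -!mulr_sumr; ring.
Qed.

Lemma cdyadic_half n b : (cdyadic n.+1 b : set R) `<=` cdyadic n b./2.
Proof.
move=> x; rewrite /cdyadic/= exprS -mulrA => /andP[].
rewrite -{1 2}(odd_double_half b) natrD -muln2 natrM.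
by case: (odd b) => /=; lra.
Qed.

Lemma charges_inW t t' v (U : set R) : flow v -> (t <= t')%N ->
  charges_in t v U -> charges_in t' v U.
Proof.
move=> fv /subnK <-; elim: (t' - t)%N => // d IH /IH {}IH.
move=> b vb; apply: (subset_trans (@cdyadic_half _ _)); apply: IH.
rewrite gt_eqF//; apply: lt_le_trans (flow_le (d + t) b fv).
by rewrite lt_neqAle eq_sym vb flow_ge0.
Qed.

Lemma flow_le_anc v n d i : flow v -> v (n + d)%N i <= v n (i %/ 2 ^ d)%N.
Proof.
move=> fv; elim: d i => [|d IH] i; first by rewrite addn0 divn1.
by rewrite addnS (le_trans (flow_le _ i fv))// expnS divnMA divn2.
Qed.

Lemma ex_nat_div_le (B e : R) : 0 < e -> exists r : nat, B / r.+1%:R <= e.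
Proof.
move=> e0; exists (Num.truncn (B / e)).
rewrite ler_pdivrMr ?ltr0n// mulrC -ler_pdivrMr//.
by apply: ltW; rewrite truncnS_gt.
Qed.

Variables (lambda : R) (c : nat -> R).
Hypotheses (lambda_gt0 : 0 < lambda) (spread : well_spread c).

(* Banach-Saks in the tree: averaging flows of bounded energy that live on
   successively finer scales brings the energy down to that of the uniform flow. *)
Lemma averaged_flow m a p : (a < 2 ^ m)%N -> exists B : R, forall r k0, exists t v,
  [/\ (m <= t)%N, flow v, forall i, v m i = (i == a)%:R & uniform_below t v] /\
  (charges_in t v (tail_cover lambda c k0) /\
   tree_energy m t v v <= 2 * (1 + p.+1%:R^-1) + B / r.+1%:R).
Proof.
move=> am; have [B hB] := hit_flow lambda_gt0 p spread am; exists B.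
set G : R := 1 + p.+1%:R^-1; have G0 : 0 <= G by rewrite addr_ge0// invr_ge0.
elim=> [|r IH] k0.
  have [N [t [v [[_ mN Nt] [[fv vm tv] [_ ch E]]]]]] := hB k0 0%N.
  exists t, v; split; first by split => //; exact: leq_trans Nt.
  by split => //; rewrite divr1 (le_trans E)// lerDr mulr_ge0.
have [t [u [[mt fu um tu] [chu Eu]]]] := IH k0.
(* The new flow is nearly uniform down to a level [N] beyond [t], from where on [u] splits evenly;
   this is the situation of [tree_energy_cross]. *)
have [N [t' [v [[tN mN Nt'] [[fv vm tv] [hv chv Ev]]]]]] := hB k0 t.
(* This weight keeps the running mean an equal-weight average and turns the error [B / (r+1)] into
   exactly [B / (r+2)]. *)
pose x : R := r.+2%:R^-1.
have tt' := leq_trans tN Nt'.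
have x0 : 0 <= x by rewrite invr_ge0.
have x1 : x <= 1 by rewrite invf_le1 ?ltr0n// ler1n.
exists t', (mix x u v); split.
  split; first exact: leq_trans Nt'.
  - by apply: mix_flow => //; rewrite x0 x1.
  - by move=> i; rewrite /mix um vm; ring.
  - by apply: mix_uniform => //; exact: uniform_belowW tu.
split.
  move=> b; have [ub|ub] := eqVneq (u t' b) 0; last first.
    by move=> _; exact: (charges_inW fu tt' chu).
  have [vb|vb] := eqVneq (v t' b) 0; last by move=> _; exact: chv.
  by rewrite /mix ub vb !mulr0 addr0 eqxx.
have Ecross := tree_energy_cross G0 fu fv mN Nt' (uniform_belowW tN tu) hv.
rewrite tree_energy_mix (tree_energy_uniform tu)//.
have y0 : 0 <= 1 - x by rewrite subr_ge0.
apply: (@le_trans _ _ ((1 - x) ^+ 2 * (2 * G + B / r.+1%:R) +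
   2 * x * (1 - x) * (2 * G) + x ^+ 2 * (2 * G + B))).
  rewrite lerD// ?lerD// ler_wpM2l ?exprn_ge0 ?mulr_ge0//.
  by rewrite (le_trans Ev)// lerDr mulr_ge0.
rewrite le_eqVlt; apply/orP; left; apply/eqP.
rewrite /x -[r.+2%:R]natr1; have : (0 : R) < r.+1%:R by rewrite ltr0n.
by move: (r.+1%:R : R) => q q0; field; apply/andP; split; lra.
Qed.

(** The uniform flow on the cell has relative energy 2, so [e] is the price of entering the covered
    set. Half of it pays for the imperfect uniformity, half for the finite number of averaged
    flows. *)
Lemma local_flow m a (e : R) k0 : (a < 2 ^ m)%N -> 0 < e -> exists tv : nat * (nat -> nat -> R),
  [/\ (m <= tv.1)%N, flow tv.2, forall i, tv.2 m i = (i == a)%:R & uniform_below tv.1 tv.2] /\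
  (charges_in tv.1 tv.2 (tail_cover lambda c k0) /\ tree_energy m tv.1 tv.2 tv.2 <= 2 + e).
Proof.
move=> am e0; have e20 : 0 < e / 2 by rewrite divr_gt0.
have [p hp] := ex_nat_div_le 2 e20.
have [B hB] := averaged_flow p am; have [r hr] := ex_nat_div_le B e20.
have [t [v [h1 [h2 h3]]]] := hB r k0; exists (t, v); split => //; split => //.
apply: (le_trans h3); rewrite mulrDr mulr1 -addrA lerD2l.
by apply: (le_trans (lerD hp hr)); lra.
Qed.

(** Flows inside different cells of level [m] have no common cell at finer levels, so cross terms
    vanish: planting a local flow in each cell costs the square of its mass times a relative energy
    of at most [2 + e]. *)
Lemma refine_flow m v (e : R) k0 : flow v -> 0 < e -> exists tv : nat * (nat -> nat -> R),
  [/\ (m < tv.1)%N, flow tv.2 & forall i, tv.2 m i = v m i] /\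
  (charges_in tv.1 tv.2 (tail_cover lambda c k0) /\
   tree_energy m tv.1 tv.2 tv.2 <= (2 + e) * level_dot m v v).
Proof.
move=> fv e0.
have /choice[f hf] : forall a, exists tv : nat * (nat -> nat -> R), (a < 2 ^ m)%N ->
  [/\ (m <= tv.1)%N, flow tv.2, forall i, tv.2 m i = (i == a)%:R & uniform_below tv.1 tv.2] /\
  (charges_in tv.1 tv.2 (tail_cover lambda c k0) /\ tree_energy m tv.1 tv.2 tv.2 <= 2 + e).
  move=> a; case: (ltnP a (2 ^ m)) => am; last by exists (0%N, fun _ _ => 0).
  by have [tv h] := local_flow k0 am e0; exists tv.
pose s := index_iota 0 (2 ^ m).
(* The maximum serves all cells at once; the successor makes the level grow strictly, which the
   iteration in [limit_flow] uses. *)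
pose th a := (f a).2; pose t := (\max_(0 <= a < 2 ^ m) (f a).1).+1.
have sP a : (a \in s) = (a < 2 ^ m)%N by rewrite mem_index_iota.
have tmax a : a \in s -> ((f a).1 <= t)%N.
  by move=> ha; rewrite ltnW// ltnS /t (leq_bigmax_seq a).
have mt : (m < t)%N.
  have h0 : (0 < 2 ^ m)%N by rewrite expn_gt0.
  by have [[h _ _ _] _] := hf _ h0; rewrite ltnS (leq_trans h)// (leq_bigmax_seq 0%N)// sP.
pose v' n i := \sum_(a <- s) v m a * th a n i.
have fth a : a \in s -> flow (th a) by rewrite sP => /hf [[]].
have fv' : flow v'.
  apply: flow_comb => //; first by move=> j; exact: flow_ge0.
  exact: flow_mass.
have th0 a d i : a \in s -> a != (i %/ 2 ^ d)%N -> th a (m + d)%N i = 0.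
  move=> ha ai; apply/eqP; rewrite eq_le (flow_ge0 _ _ (fth _ ha)) andbT.
  rewrite (le_trans (flow_le_anc _ _ _ (fth _ ha)))//.
  by move: ha; rewrite sP /th => /hf [[_ _ -> _] _]; rewrite eq_sym (negbTE ai).
have E n : (m <= n)%N -> level_dot n v' v' =
    \sum_(a <- s) (v m a) ^+ 2 * level_dot n (th a) (th a).
  move=> /subnKC <-; set d := (n - m)%N; rewrite /level_dot.
  under [RHS]eq_bigr do rewrite mulr_sumr.
  rewrite exchange_big/=; rewrite big_nat [RHS]big_nat; apply: eq_bigr => i /andP[_ hi].
  have a0s : (i %/ 2 ^ d)%N \in s by rewrite sP ltn_divLR ?expn_gt0// -expnD.
  have us : uniq s by exact: iota_uniq.
  rewrite (bigD1_seq (i %/ 2 ^ d)%N)//= [X in _ = _ + X]big_seq_cond big1 ?addr0; last first.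
    by move=> a /andP[ha hai]; rewrite th0// !mulr0.
  have -> : v' (m + d)%N i = v m (i %/ 2 ^ d)%N * th (i %/ 2 ^ d)%N (m + d)%N i.
    rewrite /v' (bigD1_seq (i %/ 2 ^ d)%N)//= big_seq_cond big1 ?addr0//.
    by move=> a /andP[ha hai]; rewrite th0// !mulr0.
  by ring.
exists (t, v'); split; split => //=.
- move=> i; rewrite /v'; case: (ltnP i (2 ^ m)) => hi; last first.
    rewrite (flow_out fv hi) big_seq big1// => a; rewrite sP /th => ha.
    have [[_ _ -> _] _] := hf _ ha; case: eqP => [ia|]; last by rewrite mulr0.
    by move: ha; rewrite -ia ltnNge hi.
  rewrite /th (bigD1_seq i) ?sP ?iota_uniq//= big_seq_cond big1 ?addr0.
    by have [[_ _ -> _] _] := hf _ hi; rewrite eqxx mulr1.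
  move=> a /andP[]; rewrite sP => ha ai; have [[_ _ -> _] _] := hf _ ha.
  by rewrite eq_sym (negbTE ai) mulr0.
- move=> b vb.
  have [a ha hab] : exists2 a, a \in s & th a t b != 0.
    apply: contrapT => hn; move/eqP: vb; apply; rewrite /v' big_seq big1// => a ha.
    by apply/eqP; rewrite mulf_eq0; apply/orP; right; apply/negP => /negP h; apply: hn; exists a.
  apply: (charges_inW (fth _ ha) (tmax _ ha)) hab.
  by move: ha; rewrite sP => /hf [_ []].
have -> : tree_energy m t v' v' =
    \sum_(a <- s) (v m a) ^+ 2 * tree_energy m t (th a) (th a).
  rewrite /tree_energy E ?(ltnW mt)//.
  under eq_big_nat => n /andP[mn _] do rewrite (E _ mn).
  rewrite exchange_big/= mulr_sumr -big_split/=; apply: eq_bigr => a _.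
  by rewrite -mulr_sumr; ring.
rewrite /level_dot mulr_sumr big_seq [leRHS]big_seq; apply: ler_sum => a ha.
rewrite mulrC -expr2 ler_wpM2r ?sqr_ge0//.
have ha' := ha; rewrite sP in ha'; have [[h1 _ _ h4] [_ h5]] := hf _ ha'.
by rewrite (tree_energy_uniform h4)//; [exact: fth|exact: tmax].
Qed.

(** Step [j] adds at most [2^-(j+1)] times the initial level energy. These costs sum to at most one,
    on top of the initial value 2 of the geometric tail; hence the factor 3. *)
Lemma limit_flow n0 v0 : flow v0 -> exists v : nat -> nat -> R,
  [/\ flow v, forall i, v n0 i = v0 n0 i,
      forall k0, exists t, charges_in t v (tail_cover lambda c k0)
    & forall T, \sum_(n0 <= n < T) level_dot n v v <= 3 * level_dot n0 v0 v0].
Proof.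
move=> fv0.
have /choice[f hf] : forall jx : nat * (nat * (nat -> nat -> R)), exists y : nat * (nat -> nat -> R),
  flow jx.2.2 ->
  [/\ (jx.2.1 < y.1)%N, flow y.2 & forall i, y.2 jx.2.1 i = jx.2.2 jx.2.1 i] /\
  (charges_in y.1 y.2 (tail_cover lambda c jx.1) /\
   tree_energy jx.2.1 y.1 y.2 y.2 <= (2 + 2 ^- jx.1.+1) * level_dot jx.2.1 jx.2.2 jx.2.2).
  move=> [j [m v]]/=; have [fv|nfv] := pselect (flow v); last by exists (m, v).
  have e0 : (0 : R) < 2 ^- j.+1 by rewrite invr_gt0 exprn_gt0.
  by have [y hy] := refine_flow m j fv e0; exists y.
pose fix X j := if j is j'.+1 then f (j', X j') else (n0, v0).
have fX j : flow (X j).2.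
  by elim: j => //= j IH; have [[]] := hf (j, X j) IH.
have Xstep j := hf (j, X j) (fX j).
have Xn j : (n0 + j <= (X j).1)%N.
  elim: j => [|j IH]; first by rewrite addn0.
  by have [[h _ _] _] := Xstep j; rewrite addnS (leq_ltn_trans IH).
have agree1 j n i : (n <= (X j).1)%N -> (X j.+1).2 n i = (X j).2 n i.
  by move=> hn; have [[_ _ h] _] := Xstep j; exact: (flow_eq_coarse (fX j.+1) (fX j) h).
have Xmono j d : ((X j).1 <= (X (j + d)%N).1)%N.
  elim: d => [|d IH]; first by rewrite addn0.
  by have [[h _ _] _] := Xstep (j + d)%N; rewrite addnS (leq_trans IH)// ltnW.
have agree j d n i : (n <= (X j).1)%N -> (X (j + d)%N).2 n i = (X j).2 n i.
  elim: d => [|d IH] hn; first by rewrite addn0.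
  by rewrite addnS agree1 ?IH// (leq_trans hn).
(* A level is frozen once the iteration has passed it, and [X n] has passed level [n], so the
   diagonal agrees with all later stages. *)
pose v n i := (X n).2 n i.
have nX n : (n <= (X n).1)%N by rewrite (leq_trans _ (Xn n))// leq_addl.
have vX j n i : (n <= (X j).1)%N -> v n i = (X j).2 n i.
  move=> hn; rewrite /v; case: (leqP n j) => [/subnKC|/ltnW/subnKC] e.
    by have := agree n (j - n)%N n i (nX n); rewrite e.
  by have := agree j (n - j)%N n i hn; rewrite e.
have fv : flow v.
  split=> [n i|n i|i].
  - exact: (flow_ge0 _ _ (fX n)).
  - rewrite (@vX n.+1) ?(leq_trans _ (nX n.+1))//.
    by rewrite (flow_split n i (fX n.+1)).
  - by case: fv0 => _ _ h; rewrite /v /= h.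
exists v; split => //.
- by move=> i; rewrite (@vX 0%N).
- move=> k0; exists (X k0.+1).1 => b vb; have [_ [h _]] := Xstep k0.
  by apply: h; rewrite (@vX k0.+1) in vb.
set e0 := level_dot n0 v0 v0.
have e00 : 0 <= e0 by apply: level_dot_ge0.
have dotX j n : (n <= (X j).1)%N -> level_dot n (X j.+1).2 (X j.+1).2 = level_dot n (X j).2 (X j).2.
  by move=> hn; apply: eq_bigr => i _; rewrite !agree1.
have n0X j : (n0 <= (X j).1)%N by rewrite (leq_trans _ (Xn j))// leq_addr.
have dot0 j : level_dot n0 (X j).2 (X j).2 = e0.
  by elim: j => // j IH; rewrite dotX.
have EX j : tree_energy n0 (X j).1 (X j).2 (X j).2 <= (3 - 2 ^- j) * e0.
  elim: j => [|j IH]; first by rewrite /tree_energy big_geq//= expr0 /e0; lra.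
  have [[h1 _ _] [_ h2]] := Xstep j.
  have h3 : level_dot (X j).1 (X j).2 (X j).2 <= e0.
    by rewrite -(dot0 j); apply: level_dot_nonincr.
  (* The levels above [(X j).1] are unchanged. From there on the new tree energy takes the place of
     the old tail, twice the level energy. *)
  rewrite /tree_energy (big_cat_nat (n0X j) (ltnW h1))/= -addrA.
  rewrite (eq_big_nat _ _ (F2 := fun n => level_dot n (X j).2 (X j).2)); last first.
    by move=> n /andP[_ hn]; rewrite dotX// ltnW.
  move: IH h2; rewrite /tree_energy/= => IH h2; apply: (le_trans (lerD (lexx _) h2)).
  have p0 : (0 : R) < 2 ^- j.+1 by rewrite invr_gt0 exprn_gt0.
  have -> : (3 : R) - 2 ^- j.+1 = 3 - 2 ^- j + 2 ^- j.+1.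
    by rewrite exprS; field; rewrite expf_neq0.
  by move: IH h3 p0; set q := 2 ^- j.+1; set z := level_dot _ _ _; nra.
move=> T.
have h := EX T.
apply: (@le_trans _ _ (\sum_(n0 <= n < (X T).1) level_dot n (X T).2 (X T).2)).
  rewrite (eq_big_nat _ _ (F2 := fun n => level_dot n (X T).2 (X T).2)); last first.
    move=> n /andP[_ nT]; apply: eq_bigr => i _; rewrite !(@vX T)//.
    by rewrite (leq_trans (ltnW nT)).
  case: (leqP n0 T) => n0T; last first.
    by rewrite big_geq ?(ltnW n0T)// sumr_ge0// => n _; exact: level_dot_ge0.
  rewrite [leRHS](big_cat_nat n0T (nX T))/= lerDl sumr_ge0// => n _.
  exact: level_dot_ge0.
have p0 : (0 : R) < 2 ^- T by rewrite invr_gt0 exprn_gt0.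
have z0 := level_dot_ge0 (X T).1 (fX T) (fX T).
by move: h; rewrite /tree_energy; nra.
Qed.

End Mix.

(** * Energies of push-forward measures *)

Section Integral.
Context d (T : measurableType d) (R : realType) (mu : {measure set T -> \bar R}).
Local Open Scope ereal_scope.

(* [ge0_le_integral] would require the inner integral of the logarithmic kernel,
   whose sign varies, to be measurable. *)
Lemma nneg_le_integral (f g : T -> \bar R) :
  (forall x, 0 <= f x) -> (forall x, f x <= g x) ->
  \int[mu]_x f x <= \int[mu]_x g x.
Proof.
move=> f0 fg; have g0 x : 0 <= g x by exact: le_trans (fg x).
rewrite !ge0_integralTE//; apply: ereal_sup_le => _ [h /= hf <-].
by exists h => //= x; exact: le_trans (fg x).
Qed.

Lemma integral_le_nneg (f g : T -> \bar R) :
  (forall x, 0 <= g x) -> (forall x, f x <= g x) ->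
  \int[mu]_x f x <= \int[mu]_x g x.
Proof.
move=> g0 fg; rewrite [leLHS]integralE.
apply: (@le_trans _ _ (\int[mu]_x f^\+ x)).
  by rewrite -[leRHS]adde0 leeD// leeNl oppe0 integral_ge0.
apply: nneg_le_integral => // x; by rewrite funeposE ge_max fg g0.
Qed.

End Integral.

Section Kernel.
Variable R : realType.
Local Open Scope ereal_scope.

Lemma measurable_logkernel :
  measurable_fun setT (fun p : (R * R) * (R * R) => logkernel p.1 p.2).
Proof.
have m1 : measurable_fun setT (fun p : (R * R) * (R * R) => p.1.1).
  exact: (measurableT_comp measurable_fst).
have m2 : measurable_fun setT (fun p : (R * R) * (R * R) => p.1.2).
  exact: (measurableT_comp measurable_snd).
have m3 : measurable_fun setT (fun p : (R * R) * (R * R) => p.2.1).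
  exact: (measurableT_comp measurable_fst measurable_snd).
have m4 : measurable_fun setT (fun p : (R * R) * (R * R) => p.2.2).
  exact: (measurableT_comp measurable_snd measurable_snd).
rewrite /logkernel; apply: measurable_fun_ifT.
- under eq_fun do rewrite -pair_eqE /pair_eq.
  by apply: measurable_and; exact: measurable_fun_eqr.
- exact: measurable_cst.
- apply/measurable_EFinP; rewrite /cdist.
  apply: measurableT_comp => //; apply: measurableT_comp; first exact: measurable_ln.
  apply: measurableT_comp; first exact: (continuous_measurable_fun (@sqrt_continuous R)).
  by apply: measurable_funD; apply: measurable_funX; exact: measurable_funB.
Qed.

(** The change of variables is carried out on the positive part of the kernel, which is measurable
    and, [H] being nonnegative, still lies below [H]. *)
Lemma energy_distribution_le d (T : measurableType d) (P0 : probability T R)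
    (Z : {mfun T >-> (R * R)%type}) (H : T -> T -> \bar R) :
  (forall u v, 0 <= H u v) -> (forall u v, logkernel (Z u) (Z v) <= H u v) ->
  energy (distribution P0 Z) <= \int[P0]_u \int[P0]_v H u v.
Proof.
move=> H0 hH; pose Kp (p : (R * R) * (R * R)) := maxe (logkernel p.1 p.2) 0.
have Kp0 p : 0 <= Kp p by rewrite /Kp le_max lexx orbT.
have mKp : measurable_fun setT Kp.
  by apply: measurable_maxe => //; exact: measurable_logkernel.
have mKp1 z : measurable_fun setT (fun w => Kp (z, w)).
  by apply: measurableT_comp => //; exact: pair1_measurable.
pose G z := \int[distribution P0 Z]_w Kp (z, w).
have G0 z : 0 <= G z by apply: integral_ge0.
have mG : measurable_fun setT G by exact: measurable_fun_fubini_tonelli_F.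
rewrite /energy /interaction; apply: (@le_trans _ _ (\int[distribution P0 Z]_z G z)).
  apply: integral_le_nneg => // z; apply: integral_le_nneg => // w.
  by rewrite /Kp le_max lexx.
rewrite ge0_integral_distribution//; apply: nneg_le_integral => u; first exact: G0.
rewrite /= /G ge0_integral_distribution//; apply: nneg_le_integral => v; first exact: Kp0.
by rewrite /= /Kp ge_max hH H0.
Qed.

End Kernel.

(** * Integrals of functions of a random cell index *)

Section Index.
Context d (T : measurableType d) (R : realType) (P0 : probability T R).
Variables (v : nat -> nat -> R) (idx : nat -> T -> nat).
Hypotheses (v_ge0 : forall n i, 0 <= v n i)
  (idx_lt : forall n u, (idx n u < 2 ^ n)%N)
  (idx_meas : forall n i, measurable [set u | idx n u = i])
  (idx_prob : forall n i, (i < 2 ^ n)%N -> P0 [set u | idx n u = i] = (v n i)%:E).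
Local Open Scope ereal_scope.

Lemma idx_decomp n (h : nat -> \bar R) u :
  h (idx n u) = \sum_(i <- index_iota 0 (2 ^ n)) h i * (\1_[set u | idx n u = i] u)%:E.
Proof.
rewrite (bigD1_seq (idx n u)) ?mem_index_iota ?idx_lt ?iota_uniq//=.
rewrite big1 ?adde0; last first.
  move=> i ine; rewrite indicE memNset ?mule0//= => ii.
  by rewrite ii eqxx in ine.
by rewrite indicE mem_set// mule1.
Qed.

Lemma measurable_idx n (h : nat -> \bar R) : measurable_fun setT (fun u => h (idx n u)).
Proof.
under eq_fun do rewrite idx_decomp.
apply: emeasurable_sum => i; apply: measurable_funeM.
exact/measurable_EFinP.
Qed.

Lemma integral_idx n (h : nat -> \bar R) : (forall i, 0 <= h i) ->
  \int[P0]_u h (idx n u) = \sum_(0 <= i < 2 ^ n) (v n i)%:E * h i.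
Proof.
move=> h0; under eq_integral do rewrite idx_decomp.
rewrite ge0_integral_sum//; last 2 first.
- by move=> i; apply: measurable_funeM; exact/measurable_EFinP.
- by move=> i u _; rewrite mule_ge0.
rewrite big_nat [RHS]big_nat; apply: eq_bigr => i /andP[_ hi].
rewrite ge0_integralZl//; last exact/measurable_EFinP.
by rewrite integral_indic// setIT -(idx_prob hi) muleC.
Qed.

Lemma integral_idx2 n (g : nat -> nat -> \bar R) : (forall i j, 0 <= g i j) ->
  \int[P0]_u \int[P0]_w g (idx n u) (idx n w) =
  \sum_(0 <= i < 2 ^ n) \sum_(0 <= j < 2 ^ n) (v n i)%:E * (v n j)%:E * g i j.
Proof.
move=> g0.
have v0 i : 0 <= (v n i)%:E by rewrite lee_fin.
under eq_integral do rewrite (integral_idx n (g0 _)).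
rewrite (integral_idx n (h := fun i => \sum_(0 <= j < 2 ^ n) (v n j)%:E * g i j)); last first.
  by move=> i; apply: sume_ge0 => j _; rewrite mule_ge0.
apply: eq_bigr => i _; rewrite ge0_sume_distrr.
  by apply: eq_bigr => j _; rewrite muleA.
by move=> j _; rewrite mule_ge0.
Qed.

Lemma integral_idx_series m (A : nat -> nat -> \bar R) (B : nat -> nat -> nat -> \bar R) :
  (forall i j, 0 <= A i j) -> (forall n i j, 0 <= B n i j) ->
  \int[P0]_u \int[P0]_w (A (idx m u) (idx m w) + \sum_(n <oo) B n (idx n u) (idx n w)) =
  \int[P0]_u \int[P0]_w A (idx m u) (idx m w) +
  \sum_(n <oo) \int[P0]_u \int[P0]_w B n (idx n u) (idx n w).
Proof.
move=> A0 B0.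
have mB n u : measurable_fun setT (fun w => B n (idx n u) (idx n w)).
  exact: measurable_idx.
have mIB n : measurable_fun setT (fun u => \int[P0]_w B n (idx n u) (idx n w)).
  by apply: (measurable_idx n (fun i => \int[P0]_w B n i (idx n w))).
transitivity (\int[P0]_u (\int[P0]_w A (idx m u) (idx m w) +
    \sum_(n <oo) \int[P0]_w B n (idx n u) (idx n w))).
  apply: eq_integral => u _; rewrite ge0_integralD//.
  - by rewrite integral_nneseries.
  - exact: measurable_idx.
  - by move=> w _; apply: nneseries_ge0.
  - exact: ge0_emeasurable_sum.
rewrite ge0_integralD//.
- by rewrite integral_nneseries// => n u _; exact: integral_ge0.
- by move=> u _; exact: integral_ge0.
- exact: (measurable_idx m (fun i => \int[P0]_w A i (idx m w))).
- by move=> u _; apply: nneseries_ge0 => n _ _; exact: integral_ge0.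
- by apply: ge0_emeasurable_sum => // n u _ _; exact: integral_ge0.
Qed.

End Index.

(** * Realising a flow as the law of a random point *)

Section Quantile.
Variable R : realType.

(** Points outside [[0, 1)], a null set for the uniform law on [[0, 1]], are sent to 0 so that every
    point gets an index. *)
Definition clip (u : R) : R := if (0 <= u) && (u < 1) then u else 0.

Lemma clip_itv u : 0 <= clip u < 1.
Proof. by rewrite /clip; case: ifP => // _; rewrite lexx ltr01. Qed.

Lemma measurable_clip : measurable_fun setT clip.
Proof.
apply: measurable_fun_ifT => //.
by apply: measurable_and; [exact: measurable_fun_ler|exact: measurable_fun_ltr].
Qed.

Lemma measurable_clip_itv (a b : R) : measurable [set u | a <= clip u < b].
Proof.
have := measurable_clip measurableT (measurable_itv `[a, b[).
by rewrite setTI; congr measurable; apply/seteqP; split => u; rewrite /= in_itv.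
Qed.

Lemma uniform_clip (a b : R) : 0 <= a -> a <= b -> b <= 1 ->
  uniform_prob (@ltr01 R) [set u | a <= clip u < b] = (b - a)%:E.
Proof.
move=> a0 ab b1; set A := [set u | _].
have mA : measurable A by exact: measurable_clip_itv.
have -> : uniform_prob (@ltr01 R) A = lebesgue_measure (A `&` `[0%R, 1%R]).
  rewrite /uniform_prob integral_uniform_pdf (eq_integral (cst 1%E)).
    by rewrite integral_cst ?mul1e//; exact: measurableI.
  move=> x; rewrite inE => -[_]; rewrite /= in_itv/= /uniform_pdf => ->.
  by rewrite subr0 invr1.
have lab : lebesgue_measure `[a, b[%classic = (b - a)%:E.
  rewrite lebesgue_measure_itv/= lte_fin; case: ltP => // ba.
  by rewrite (_ : b = a) ?subrr//; apply/eqP; rewrite eq_le ba ab.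
apply/eqP; rewrite eq_le; apply/andP; split.
  apply: (@le_trans _ _ (lebesgue_measure (`[a, b[%classic `|` [set (1:R)]))).
    apply: le_measure; rewrite ?inE//.
    - exact: measurableI.
    - exact: measurableU.
    move=> u [] /= hu; rewrite in_itv/= => /andP[u0 u1].
    have [->|un1] := eqVneq u 1; [by right|left].
    have ult : u < 1 by rewrite lt_neqAle un1.
    by move: hu; rewrite /A/= /clip u0 ult in_itv.
  apply: (le_trans (measureU2 _ _ _)) => //.
  rewrite -[leRHS]adde0; apply: leeD.
    by rewrite -lab.
  by rewrite le_eqVlt; apply/orP; left; apply/eqP; exact: lebesgue_measure_set1.
rewrite -lab; apply: le_measure; rewrite ?inE//; first exact: measurableI.
move=> u /=; rewrite in_itv/= => /andP[au ub].
have u1 : u < 1 by exact: lt_le_trans b1.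
have u0 : 0 <= u by exact: le_trans au.
by rewrite /A/= /clip u0 u1 au ub; split => //; rewrite in_itv/= u0 ltW.
Qed.

(** Quantile construction: a uniform point is located among the cumulative masses of each level.
    Those of level [n + 1] refine those of level [n], so the indices are nested; a cell of mass zero
    has an empty range and is never selected. *)
Lemma flow_index (v : nat -> nat -> R) : flow v ->
  exists d (T : measurableType d) (P0 : probability T R) (idx : nat -> T -> nat),
  [/\ forall n u, (idx n u < 2 ^ n)%N,
      forall n i, measurable [set u | idx n u = i],
      forall n i, (i < 2 ^ n)%N -> P0 [set u | idx n u = i] = (v n i)%:E,
      forall n u, (idx n.+1 u)./2 = idx n u
    & forall n u, v n (idx n u) != 0].
Proof.
move=> fv; pose cum n i := \sum_(0 <= k < i) v n k.
have cumS n i : cum n i.+1 = cum n i + v n i by rewrite /cum big_nat_recr.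
have cum_le n i j : (i <= j)%N -> cum n i <= cum n j.
  move=> ij; rewrite /cum (big_cat_nat (leq0n i) ij)/= lerDl sumr_ge0// => k _.
  exact: flow_ge0.
have cum0 n : cum n 0%N = 0 by rewrite /cum big_geq.
have cum1 n : cum n (2 ^ n)%N = 1 by exact: flow_mass.
have cum2 n i : cum n.+1 i.*2 = cum n i.
  by rewrite /cum sum_nat_double; apply: eq_bigr => k _; rewrite -flow_split.
pose cell n u i := (i < 2 ^ n)%N && (cum n i <= clip u < cum n i.+1).
have cell_ex n u : exists i, cell n u i.
  have /andP[c0 c1] := clip_itv u.
  have ex : exists i, clip u < cum n i.+1.
    exists (2 ^ n).-1; by rewrite prednK ?expn_gt0// cum1.
  case: (ex_minnP ex) => i hi imin; exists i; rewrite /cell hi andbT.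
  have iN : (i < 2 ^ n)%N.
    have := imin (2 ^ n).-1; rewrite prednK ?expn_gt0// cum1 => /(_ c1) h.
    by rewrite (leq_ltn_trans h)// prednK ?expn_gt0.
  rewrite iN/=; case: i {hi iN} imin => [|i] imin; first by rewrite cum0.
  by rewrite leNgt; apply/negP => /imin; rewrite ltnn.
have cell_uniq n u i j : cell n u i -> cell n u j -> i = j.
  move=> /andP[_ /andP[i1 i2]] /andP[_ /andP[j1 j2]].
  apply/eqP; rewrite eqn_leq; apply/andP; split; rewrite leqNgt; apply/negP => ij.
    by have := le_lt_trans (le_trans (cum_le n _ _ ij) i1) j2; rewrite ltxx.
  by have := le_lt_trans (le_trans (cum_le n _ _ ij) j1) i2; rewrite ltxx.
pose idx n u := projT1 (cid (cell_ex n u)).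
have idxP n u : cell n u (idx n u) by exact: (projT2 (cid (cell_ex n u))).
have idxE n i : (i < 2 ^ n)%N ->
    [set u | idx n u = i] = [set u | cum n i <= clip u < cum n i.+1].
  move=> hi; apply/seteqP; split => u /=.
    by move=> <-; have /andP[_ ->] := idxP n u.
  by move=> hu; apply: (cell_uniq n u) => //; rewrite /cell hi.
exists _, _, (uniform_prob (@ltr01 R)), idx; split.
- by move=> n u; have /andP[] := idxP n u.
- move=> n i; case: (ltnP i (2 ^ n)) => hi.
    by rewrite idxE//; exact: measurable_clip_itv.
  rewrite (_ : [set u | _] = set0)//; apply/seteqP; split => // u /= e.
  by have /andP[] := idxP n u; rewrite e ltnNge hi.
- move=> n i hi; rewrite idxE//.
  apply: (etrans (@uniform_clip (cum n i) (cum n i.+1) _ _ _)).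
  + by rewrite -(cum0 n) cum_le.
  + exact: cum_le.
  + by rewrite -(cum1 n) cum_le.
  + by rewrite cumS addrAC subrr add0r.
- move=> n u; apply: (cell_uniq n u) => //.
  have /andP[h1 /andP[h2 h3]] := idxP n.+1 u; set k := idx n.+1 u in h1 h2 h3 *.
  rewrite /cell; apply/andP; split; first by rewrite expnS in h1; lia.
  rewrite -(cum2 n k./2) -(cum2 n k./2.+1) (le_trans _ h2) ?(lt_le_trans h3)//; apply: cum_le; lia.
- move=> n u; have /andP[_ /andP[h1 h2]] := idxP n u.
  have := le_lt_trans h1 h2; rewrite cumS => h.
  by rewrite gt_eqF//; move: h; rewrite ltrDl.
Qed.

(** Left endpoints of nested cells increase and right endpoints decrease, so the limit of the left
    endpoints lies in all the closed cells; as a pointwise limit it is measurable. *)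
Lemma index_point d (T : measurableType d) (idx : nat -> T -> nat) :
  (forall n i, measurable [set u | idx n u = i]) ->
  (forall n u, (idx n u < 2 ^ n)%N) -> (forall n u, (idx n.+1 u)./2 = idx n u) ->
  exists2 X : T -> R, measurable_fun setT X & forall n u, cdyadic n (idx n u) (X u).
Proof.
move=> midx idx_lt idxS.
pose x n u : R := (idx n u)%:R / 2 ^+ n.
have p0 n : (0 : R) < 2 ^+ n by rewrite exprn_gt0.
have xS n u : x n u <= x n.+1 u /\ x n.+1 u + (2 ^+ n.+1)^-1 <= x n u + (2 ^+ n)^-1.
  rewrite /x -(idxS n u) -[(idx n.+1 u)%:R](congr1 _ (odd_double_half _)).
  rewrite natrD -muln2 natrM exprS.
  have := p0 n; set q := 2 ^+ n => q0.
  have -> : (2 * q)^-1 = q^-1 / 2 by field; rewrite gt_eqF.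
  have : 0 < q^-1 by rewrite invr_gt0.
  set r := q^-1; set y := (_./2)%:R; case: (odd _) => /= r0; split; nra.
have xmono u : {homo x^~ u : n m / (n <= m)%N >-> n <= m}.
  by apply/nondecreasing_seqP => n; have [] := xS n u.
have xup n u k : x (n + k)%N u + (2 ^+ (n + k))^-1 <= x n u + (2 ^+ n)^-1.
  elim: k => [|k IH]; first by rewrite addn0.
  by rewrite addnS; apply: le_trans IH; have [] := xS (n + k)%N u.
have xle n m u : x m u <= x n u + (2 ^+ n)^-1.
  apply: (@le_trans _ _ (x (n + m)%N u)); first by rewrite xmono// leq_addl.
  by apply: le_trans (xup n u m); rewrite lerDl invr_ge0 ltW.
have xcvg u : cvgn (x^~ u).
  apply: nondecreasing_is_cvgn; first exact: xmono.
  by exists (x 0%N u + (2 ^+ 0)^-1) => _ [m _ <-]; exact: xle.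
exists (fun u => limn (x^~ u)).
  apply: (@measurable_fun_cvg _ _ _ _ x) => //.
    move=> n; apply/measurable_EFinP.
    exact: (measurable_idx idx_lt midx n (fun i => (i%:R / 2 ^+ n : R)%:E)).
move=> n u; rewrite /cdyadic/=.
have h1 : x n u <= limn (x^~ u) by apply: nondecreasing_cvgn_le.
have h2 : limn (x^~ u) <= x n u + (2 ^+ n)^-1.
  by apply: limr_le => //; apply: nearW => m; exact: xle.
have e : x n u + (2 ^+ n)^-1 = ((idx n u)%:R + 1) / 2 ^+ n by rewrite mulrDl div1r.
move: h1 h2; rewrite e /x.
by rewrite ler_pdivrMr// ler_pdivlMr// mulrC => -> ->.
Qed.

End Quantile.

(** * The logarithmic kernel on dyadic cells *)

Definition ndist (i j : nat) : nat := (i - j + (j - i))%N.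

Lemma ndist_lt K i j : (i < K)%N -> (j < K)%N -> (ndist i j < K)%N.
Proof. by rewrite /ndist; lia. Qed.

Lemma ndist_eq0 i j : (ndist i j == 0%N) = (i == j).
Proof. by rewrite /ndist; lia. Qed.

(** [4 * a + 1] is the second quarter of cell [a], at distance at least a quarter of the cell length
    from its ends. *)
Lemma quarter_lt m a : (a < 2 ^ m)%N -> (4 * a + 1 < 2 ^ m.+2)%N.
Proof. by rewrite !expnS; lia. Qed.

Section KernelBound.
Variable R : realType.

Lemma cdist_axis (x y : R) : cdist (x, 0) (y, 0) = `|x - y|.
Proof. by rewrite /cdist/= subrr expr0n addr0 sqrtr_sqr. Qed.

Lemma logkernel_axis (x y : R) : x != y -> logkernel (x, 0) (y, 0) = (- ln `|x - y|)%:E.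
Proof.
by move=> xy; rewrite /logkernel cdist_axis -pair_eqE /pair_eq/= eqxx andbT (negbTE xy).
Qed.

Lemma ln2_gt0 : (0 : R) < ln 2.
Proof. by rewrite ln_gt0// ltr1n. Qed.

Lemma ln_pow2 n : ln (2 ^+ n) = n%:R * ln 2 :> R.
Proof. by rewrite lnXn// mulr_natl. Qed.

Lemma ln_dist_le n (x y : R) : 1 < 2 ^+ n * `|x - y| -> - ln `|x - y| <= n%:R * ln 2.
Proof.
move=> h; have p0 : (0 : R) < 2 ^+ n by rewrite exprn_gt0.
have d0 : 0 < `|x - y| by rewrite -(pmulr_rgt0 _ p0) (lt_trans _ h).
rewrite lerNl -ln_pow2 -lnV ?posrE// ler_ln ?posrE ?invr_gt0//.
by rewrite -[leLHS]mul1r ler_pdivrMr// mulrC ltW.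
Qed.

(** Once [2^N |x - y| > 1] the kernel is at most [N ln 2], so counting the levels at which the
    points are still close bounds it. For [x = y] the count is infinite. *)
Lemma logkernel_series (x y : R) (close : nat -> bool) n0 :
  (forall n, 2 ^+ n * `|x - y| <= 1 -> close n) ->
  (logkernel (x, 0%R) (y, 0%R) <= (n0%:R * ln 2)%:E +
     \sum_(n <oo) (ln 2 * ((n0 <= n)%N && close n)%:R)%:E)%E.
Proof.
move=> hc; pose s N := (n0 + \sum_(0 <= n < N) ((n0 <= n) && close n))%N.
(* Either all levels from [n0] on have been close so far and the count keeps pace with [N], or an
   earlier separation has already bounded the kernel by the count. *)
have claim N : (n0 <= N)%N ->
    (N <= s N)%N \/ (x != y /\ - ln `|x - y| <= (s N)%:R * ln 2).
  move=> /subnK <-; elim: (N - n0)%N => [|k]; first by left; rewrite add0n /s leq_addr.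
  rewrite addSn; set M := (k + n0)%N.
  have sS : s M.+1 = (s M + close M)%N.
    by rewrite /s big_nat_recr//= addnA /M leq_addl.
  have sMS : (s M <= s M.+1)%N by rewrite sS leq_addr.
  have stay : x != y /\ - ln `|x - y| <= (s M)%:R * ln 2 ->
      x != y /\ - ln `|x - y| <= (s M.+1)%:R * ln 2.
    move=> [xy h]; split=> //; apply: (le_trans h).
    by rewrite ler_pM2r ?ln2_gt0// ler_nat.
  case=> [h|/stay]; last by right.
  have [cl|ncl] := boolP (close M); first by left; rewrite sS cl addn1.
  right; apply: stay.
  have h1 : 1 < 2 ^+ M * `|x - y|.
    by rewrite ltNge; apply/negP => /hc; rewrite (negbTE ncl).
  split; last by apply: (le_trans (ln_dist_le h1)); rewrite ler_pM2r ?ln2_gt0// ler_nat.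
  by apply/eqP => xy; move: h1; rewrite xy subrr normr0 mulr0 ltr10.
have sle N : (((s N)%:R * ln 2 : R)%:E <= (n0%:R * ln 2)%:E +
     \sum_(n <oo) (ln 2 * ((n0 <= n)%N && close n)%:R)%:E)%E.
  have h : (\sum_(0 <= n < N) (ln 2 * ((n0 <= n)%N && close n)%:R)%:E <=
      \sum_(n <oo) (ln 2 * ((n0 <= n)%N && close n)%:R)%:E :> \bar R)%E.
    apply: nneseries_lim_ge => n _ _; rewrite lee_fin mulr_ge0// ltW//.
    exact: ln2_gt0.
  apply: (le_trans _ (leeD (lexx _) h)).
  rewrite sumEFin -EFinD lee_fin -mulr_sumr -natr_sum mulrC [X in X + _]mulrC -mulrDr.
  by rewrite -natrD.
have [xy|xy] := eqVneq x y.
  have -> : ((n0%:R * ln 2 : R)%:E +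
     \sum_(n <oo) (ln 2 * ((n0 <= n)%N && close n)%:R)%:E = +oo)%E.
    apply/eqyP => A A0; pose N := maxn n0 (Num.truncn (A / ln 2)).+1.
    apply: le_trans (sle N); rewrite lee_fin -ler_pdivrMr ?ln2_gt0//.
    have [h|[]] := claim N (leq_maxl _ _); last by rewrite xy eqxx.
    apply: (@le_trans _ _ (Num.truncn (A / ln 2)).+1%:R).
      by rewrite ltW// truncnS_gt.
    by rewrite ler_nat (leq_trans _ h)// leq_maxr.
  by rewrite leey.
rewrite logkernel_axis//; pose N := maxn n0 (Num.truncn (- ln `|x - y| / ln 2)).+1.
apply: le_trans (sle N); rewrite lee_fin.
have [h|[]//] := claim N (leq_maxl _ _).
rewrite -ler_pdivrMr ?ln2_gt0//.
apply: (@le_trans _ _ (Num.truncn (- ln `|x - y| / ln 2)).+1%:R).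
  by rewrite ltW// truncnS_gt.
by rewrite ler_nat (leq_trans _ h)// leq_maxr.
Qed.

(* The infimum of the kernel over two level-[m] cells at index distance [d]. *)
Definition cell_kernel (m d : nat) : R := m%:R * ln 2 - ln d.+1%:R.

(** Bounds the excess of the kernel over [cell_kernel] for points in the second quarters of their
    cells. At [d = 0] it pays for the two levels between [m] and [m + 2], since [2 ln 2 <= 2]. *)
Definition cell_error (d : nat) : R := if d == 0%N then 2 else 2 / d%:R.

Lemma cell_kernel_ge0 m d : (d < 2 ^ m)%N -> 0 <= cell_kernel m d.
Proof.
move=> h; rewrite /cell_kernel subr_ge0 -ln_pow2 ler_ln ?posrE ?exprn_gt0 ?ltr0n//.
by rewrite -natrX ler_nat.
Qed.

Lemma cell_error_ge0 d : 0 <= cell_error d.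
Proof. by rewrite /cell_error; case: ifP. Qed.

Lemma cdyadic_close n i j (x y : R) : cdyadic n i x -> cdyadic n j y ->
  2 ^+ n * `|x - y| <= 1 -> (ndist i j <= 2)%N.
Proof.
rewrite /cdyadic/= => /andP[i1 i2] /andP[j1 j2].
rewrite -[X in X * _](@ger0_norm _ (2 ^+ n)) ?exprn_ge0// -normrM mulrBr ler_norml => /andP[h1 h2].
have a : (i <= j + 2)%N by rewrite -(ler_nat R) natrD; lra.
have b : (j <= i + 2)%N by rewrite -(ler_nat R) natrD; lra.
by rewrite /ndist; lia.
Qed.

Lemma cdyadic_far_dist m i j (x y : R) :
  cdyadic m.+2 (4 * i + 1) x -> cdyadic m.+2 (4 * j + 1) y -> i != j ->
  (4 * ndist i j)%:R - 1 <= 2 ^+ m.+2 * `|x - y|.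
Proof.
move=> + + ij.
wlog lij : i j x y ij / (i < j)%N.
  move=> W hx hy; case: (ltngtP i j) => h; first exact: W.
    by rewrite distrC [ndist i j]addnC; apply: W => //; rewrite eq_sym.
  by rewrite h eqxx in ij.
rewrite /cdyadic/= => /andP[i1 i2] /andP[j1 j2].
have -> : ndist i j = (j - i)%N by rewrite /ndist; lia.
rewrite -[X in X * _](@ger0_norm _ (2 ^+ m.+2)) ?exprn_ge0// -normrM mulrBr.
rewrite distrC; apply: le_trans (ler_norm _).
rewrite natrM natrB ?(ltnW lij)//; rewrite natrD natrM in i1 i2 j1 j2.
by lra.
Qed.

(** With [d] the index distance, second quarters are at least [(d - 1/4) 2^-m] apart, and [ln ((d+1)
    / (d - 1/4)) <= (5/4) / (d - 1/4) <= 2/d]. Without the quarters, adjacent cells could come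
    arbitrarily close. *)
Lemma logkernel_far m i j (x y : R) :
  cdyadic m.+2 (4 * i + 1) x -> cdyadic m.+2 (4 * j + 1) y -> i != j ->
  (logkernel (x, 0%R) (y, 0%R) <= (cell_kernel m (ndist i j) + cell_error (ndist i j))%:E)%E.
Proof.
move=> hx hy ij; have h := cdyadic_far_dist hx hy ij.
have d0 : (0 < ndist i j)%N by rewrite /ndist; lia.
move: h d0; move: (ndist i j) => d h d0.
have d1 : (1 : R) <= d%:R by rewrite ler1n.
have p0 : (0 : R) < 2 ^+ m by rewrite exprn_gt0.
have a0 : (0 : R) < d%:R - 4^-1 by lra.
have h2 : (d%:R - 4^-1) / 2 ^+ m <= `|x - y|.
  rewrite ler_pdivrMr// mulrC; move: h; rewrite natrM !exprS.
  by move: (2 ^+ m) (`|x - y|) => p z; lra.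
have z0 : 0 < `|x - y| by apply: lt_le_trans h2; rewrite divr_gt0.
have xy : x != y by rewrite -subr_eq0 -normr_gt0.
rewrite logkernel_axis// lee_fin /cell_kernel /cell_error -if_neg -lt0n d0.
have h3 : - ln `|x - y| <= m%:R * ln 2 - ln (d%:R - 4^-1).
  rewrite lerNl opprB -ln_pow2 -ln_div ?posrE//.
  by rewrite ler_ln ?posrE// divr_gt0.
apply: (le_trans h3); rewrite -addrA lerD2l -lerBlDl opprK addrC -ln_div ?posrE ?ltr0n//.
have -> : d.+1%:R / (d%:R - 4^-1) = 1 + (5 / 4) / (d%:R - 4^-1) :> R.
  by rewrite -(natr1 d); field; rewrite gt_eqF//; lra.
apply: (le_trans (le_ln1Dx _)).
  by apply: (@lt_trans _ _ 0); rewrite ?ltrN10// divr_gt0//; lra.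
by rewrite ler_pdivrMr// mulrAC ler_pdivlMr ?ltr0n//; lra.
Qed.

Lemma logkernel_ge_cell m i j (x y : R) : cdyadic m i x -> cdyadic m j y ->
  ((cell_kernel m (ndist i j))%:E <= logkernel (x, 0%R) (y, 0%R))%E.
Proof.
move=> hx hy; have [->|xy] := eqVneq x y; first by rewrite /logkernel eqxx leey.
rewrite logkernel_axis// lee_fin /cell_kernel.
have p0 : (0 : R) < 2 ^+ m by rewrite exprn_gt0.
have h : 2 ^+ m * `|x - y| <= (ndist i j).+1%:R.
  move: hx hy; rewrite /cdyadic/= => /andP[i1 i2] /andP[j1 j2].
  rewrite -[X in X * _](@ger0_norm _ (2 ^+ m)) ?exprn_ge0// -normrM mulrBr ler_norml.
  have a : i%:R <= j%:R + (ndist i j)%:R :> R by rewrite -natrD ler_nat /ndist; lia.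
  have b : j%:R <= i%:R + (ndist i j)%:R :> R by rewrite -natrD ler_nat /ndist; lia.
  by rewrite -natr1; apply/andP; split; lra.
have z0 : 0 < `|x - y| by rewrite normr_gt0 subr_eq0.
rewrite lerBlDr -lerBlDl opprK -ln_pow2 -lnM ?posrE//.
by rewrite ler_ln ?posrE ?ltr0n// mulr_gt0.
Qed.

Lemma count_close (K i : nat) : (\sum_(0 <= j < K) (ndist i j <= 2) <= 5)%N.
Proof.
have -> : (\sum_(0 <= j < K) (ndist i j <= 2)
    = size [seq j <- iota 0 K | ndist i j <= 2])%N.
  rewrite size_filter -sum1_count [RHS]big_mkcond /index_iota subn0.
  by apply: eq_bigr => j _; case: ifP.
rewrite -(size_iota (i - 2) 5); apply: uniq_leq_size.
  by rewrite filter_uniq// iota_uniq.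
by move=> j; rewrite mem_filter !mem_iota /ndist => /andP[h _]; lia.
Qed.

(** [v i * v j] is at most the mean of the two squares, and an index has at most five neighbours
    within distance two, itself included. *)
Lemma sum_close_le (K : nat) (v : nat -> R) : (forall i, 0 <= v i) ->
  \sum_(0 <= i < K) \sum_(0 <= j < K) v i * v j * (ndist i j <= 2)%N%:R <=
  5 * \sum_(0 <= i < K) v i * v i.
Proof.
move=> v0; pose c i j : R := (ndist i j <= 2)%N%:R.
have cC i j : c i j = c j i by rewrite /c /ndist addnC.
have c0 i j : 0 <= c i j by rewrite ler0n.
have S i : \sum_(0 <= j < K) c i j <= 5 by rewrite -natr_sum ler_nat count_close.
pose A := \sum_(0 <= i < K) \sum_(0 <= j < K) v i ^+ 2 * c i j.
have A5 : A <= 5 * \sum_(0 <= i < K) v i * v i.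
  rewrite /A mulr_sumr; apply: ler_sum => i _.
  by rewrite -mulr_sumr mulrC -expr2 ler_wpM2r// sqr_ge0.
have A' : \sum_(0 <= i < K) \sum_(0 <= j < K) v j ^+ 2 * c i j = A.
  by rewrite exchange_big; apply: eq_bigr => i _; apply: eq_bigr => j _; rewrite cC.
apply: (@le_trans _ _ (2^-1 * (A + A))); last by lra.
rewrite -{2}A' /A -big_split mulr_sumr; apply: ler_sum => i _.
rewrite -big_split mulr_sumr; apply: ler_sum => j _ /=.
rewrite -/(c i j) -mulrDl mulrA ler_wpM2r//.
have := sqr_ge0 (v i - v j); lra.
Qed.

End KernelBound.

Definition mfun_of d d' (T : measurableType d) (T' : measurableType d') (f : T -> T')
    (mf : measurable_fun setT f) : {mfun T >-> T'} :=
  HB.pack f (isMeasurableFun.Build _ _ _ _ f mf).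

(** * Supports and admissibility of laws on the real axis *)

Section Support.
Variable R : realType.

Lemma ball_prodE (z : R * R) (e : R) : ball z e = ball z.1 e `*` ball z.2 e.
Proof. by apply/seteqP; split => w. Qed.

Lemma measurable_ball_prod (z : R * R) (e : R) : measurable (ball z e).
Proof. by rewrite ball_prodE; apply: measurableX; exact: measurable_ball. Qed.

Lemma closed_msupport (mu : probability (R * R)%type R) : closed (msupport mu).
Proof.
move=> z cz e e0; have e20 : 0 < e / 2 by rewrite divr_gt0.
have [w [sw zw]] := cz _ (nbhsx_ballx z _ e20).
apply: (lt_le_trans (sw _ e20)); apply: le_measure; rewrite ?inE.
- exact: measurable_ball_prod.
- exact: measurable_ball_prod.
by move=> y wy; rewrite [e]splitr; apply: ball_triangle wy.
Qed.

Lemma measurable_axis d (T : measurableType d) (X : T -> R) :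
  measurable_fun setT X -> measurable_fun setT (fun u => (X u, 0 : R)).
Proof. by move=> mX; exact: measurable_fun_pair. Qed.

Definition axis_law d (T : measurableType d) (P0 : probability T R) (X : T -> R)
    (mX : measurable_fun setT X) : probability (R * R)%type R :=
  distribution P0 (mfun_of (measurable_axis mX)).

Lemma energy_axis_law_le d (T : measurableType d) (P0 : probability T R) (X : T -> R)
    (mX : measurable_fun setT X) (H : T -> T -> \bar R) :
  (forall u w, (0 <= H u w)%E) ->
  (forall u w, (logkernel (X u, 0%R) (X w, 0%R) <= H u w)%E) ->
  (energy (axis_law P0 mX) <= \int[P0]_u \int[P0]_w H u w)%E.
Proof. by move=> H0 hH; exact: energy_distribution_le. Qed.

Lemma msupport_axis_law d (T : measurableType d) (P0 : probability T R) (X : T -> R)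
    (mX : measurable_fun setT X) (D : set R) : closed D -> (forall u, D (X u)) ->
  msupport (axis_law P0 mX) `<=` real_axis D.
Proof.
move=> cD DX z hz.
have hit e : 0 < e -> exists u, ball z e (X u, 0).
  move=> e0; apply: contrapT => hn; have := hz _ e0.
  rewrite -[axis_law _ _ _]/(P0 [set u | ball z e (X u, 0)]).
  rewrite (_ : [set u | _] = set0) ?measure0 ?ltxx//.
  by apply/seteqP; split => // u hu; apply: hn; exists u.
split.
  apply/eqP; rewrite -normr_le0; apply/ler_addgt0Pr => e e0; rewrite add0r.
  by have [u [_]] := hit _ e0; rewrite /ball/= subr0 => /ltW.
apply: cD => B /nbhs_ballP[e e0 eB].
have [u [hu _]] := hit _ e0.
by exists (X u); split => //; apply: eB.
Qed.

Lemma cdyadicE n b : cdyadic n b = `[b%:R / 2 ^+ n, (b%:R + 1) / 2 ^+ n]%classic :> set R.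
Proof.
have p0 : (0 : R) < 2 ^+ n by rewrite exprn_gt0.
apply/seteqP; split => x; rewrite /cdyadic/= in_itv/= => /andP[h1 h2].
  by rewrite ler_pdivrMr// ler_pdivlMr// mulrC h1 h2.
by move: h1 h2; rewrite ler_pdivrMr// ler_pdivlMr// mulrC => -> ->.
Qed.

(** At a level [t] given by [charges_in], the random point stays in a finite union of closed cells.
    That union is closed, so it contains the support, and it lies in [U k]. *)
Lemma axis_law_admissible d (T : measurableType d) (P0 : probability T R) (X : T -> R)
    (mX : measurable_fun setT X) (v : nat -> nat -> R) (idx : nat -> T -> nat) (U : nat -> set R) :
  (forall n u, (idx n u < 2 ^ n)%N) -> (forall n u, v n (idx n u) != 0) ->
  (forall n u, cdyadic n (idx n u) (X u)) ->
  (forall k, exists t, charges_in t v (U k)) ->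
  admissible (real_axis [set x | forall k, U k x]) (axis_law P0 mX).
Proof.
move=> idx_lt vidx Xidx ch; split.
  apply: (@subclosed_compact _ _ (real_axis `[0, 1]%classic)).
  - exact: closed_msupport.
  - have -> : real_axis `[0, 1]%classic = `[0, 1]%classic `*` [set 0] :> set (R * R).
      by apply/seteqP; split => z [].
    by apply: compact_setX; [exact: segment_compact|exact: compact_set1].
  - apply: msupport_axis_law => [|u]; first exact: itv_closed.
    have := Xidx 0%N u; rewrite cdyadicE expr0 !divr1.
    by have := idx_lt 0%N u; rewrite expn0 ltnS leqn0 => /eqP ->; rewrite add0r.
move=> z hz; have suppD D : closed D -> (forall u, D (X u)) -> real_axis D z.
  by move=> cD DX; exact: (msupport_axis_law cD DX hz).
split; first by have [] := suppD setT closedT (fun=> I).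
move=> k; have [t ht] := ch k.
pose A := [set b | (b < 2 ^ t)%N /\ v t b != 0].
have [_ [b [_ vb] hb]] : real_axis (\bigcup_(b in A) cdyadic t b) z.
  apply: suppD => [|u]; last by exists (idx t u) => //; split.
  apply: closed_bigcup => [|b _]; last by rewrite cdyadicE; exact: itv_closed.
  apply: (@sub_finite_set _ _ `I_(2 ^ t)); last exact: finite_II.
  by move=> b [].
exact: ht hb.
Qed.

End Support.

(** * Energy of the law of a flow *)

Section FlowEnergy.
Variable R : realType.

(** The kernel is dominated by a cell term at level [m] plus [ln 2] for each level from [m + 2] on
    where the two cells are within distance two. Such a level costs at most five times its
    [level_dot], and [tails] brings the total to [15 = 5 * 3]. *)
Lemma flow_energy (v : nat -> nat -> R) m (U : nat -> set R) : flow v ->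
  (forall i, v m.+2 i != 0 -> exists j, i = (4 * j + 1)%N) ->
  (forall N, \sum_(m.+2 <= n < N) level_dot n v v <= 3 * level_dot m.+2 v v) ->
  (forall k, exists t, charges_in t v (U k)) ->
  exists2 nu : probability (R * R)%type R,
    admissible (real_axis [set x | forall k, U k x]) nu &
    (energy nu <= (\sum_(0 <= i < 2 ^ m) \sum_(0 <= j < 2 ^ m) v m i * v m j *
       (cell_kernel R m (ndist i j) + cell_error R (ndist i j))
       + 15 * level_dot m v v)%:E)%E.
Proof.
move=> fv v4 tails ch.
have [d [T [P0 [idx [idx_lt midx Pidx idxS vidx]]]]] := flow_index fv.
have [X mX Xidx] := index_point R midx idx_lt idxS.
exists (axis_law P0 mX); first exact: (axis_law_admissible P0 mX idx_lt vidx Xidx ch).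
pose A i j : R := if (i < 2 ^ m)%N && (j < 2 ^ m)%N
  then cell_kernel R m (ndist i j) + cell_error R (ndist i j) else 0.
pose B n i j : R := ln 2 * ((m.+2 <= n)%N && (ndist i j <= 2)%N)%:R.
have A0 i j : (0 <= (A i j)%:E)%E.
  rewrite lee_fin /A; case: ifP => // /andP[hi hj].
  by rewrite addr_ge0 ?cell_error_ge0// cell_kernel_ge0// ndist_lt.
have B0 n i j : (0 <= (B n i j)%:E)%E.
  by rewrite lee_fin /B mulr_ge0// ltW// ln2_gt0.
pose H u w := ((A (idx m u) (idx m w))%:E + \sum_(n <oo) (B n (idx n u) (idx n w))%:E)%E.
have sum0 u w : (0 <= \sum_(n <oo) (B n (idx n u) (idx n w))%:E)%E by exact: nneseries_ge0.
have H0 u w : (0 <= H u w)%E by rewrite adde_ge0.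
have idx2 u : idx m.+2 u = (4 * idx m u + 1)%N.
  have [j hj] := v4 _ (vidx m.+2 u).
  by rewrite -(idxS m) -(idxS m.+1) hj; lia.
have hH u w : (logkernel (X u, 0%R) (X w, 0%R) <= H u w)%E.
  rewrite /H /A !idx_lt/=.
  (* In different cells the quarter placement bounds the kernel by the first term alone; in the same
     cell the levels are counted from [m + 2]. *)
  have [e|ij] := eqVneq (idx m u) (idx m w); last first.
    apply: (@le_trans _ _ ((cell_kernel R m (ndist (idx m u) (idx m w)) +
      cell_error R (ndist (idx m u) (idx m w)))%:E + 0)%E); last exact: leeD.
    rewrite adde0; apply: logkernel_far ij.
      by rewrite -idx2; exact: Xidx.
    by rewrite -idx2; exact: Xidx.
  rewrite e /ndist subnn addn0.
  have -> : cell_kernel R m 0 + cell_error R 0 = m%:R * ln 2 + 2.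
    by rewrite /cell_kernel /cell_error eqxx ln1 subr0.
  apply: (@le_trans _ _ ((m.+2%:R * ln 2)%:E + \sum_(n <oo) (B n (idx n u) (idx n w))%:E)%E).
    apply: logkernel_series => n hn.
    exact: cdyadic_close (Xidx n u) (Xidx n w) hn.
  rewrite leeD2r// lee_fin -[m.+2]addn2 natrD mulrDl lerD2l.
  have := @le_ln1Dx R 1; rewrite -[1 + 1]/(2 : R) => h.
  by rewrite ler_piMr// h// ltrN10 || exact: (lt_trans (ltrN10 R) ltr01).
apply: (le_trans (energy_axis_law_le P0 mX H0 hH)).
rewrite (integral_idx_series P0 idx_lt midx m A0 B0).
rewrite (integral_idx2 (fun n i => flow_ge0 n i fv) idx_lt midx Pidx m A0).
rewrite EFinD; apply: leeD.
  rewrite -sumEFin le_eqVlt; apply/orP; left; apply/eqP.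
  rewrite big_nat [RHS]big_nat; apply: eq_bigr => i /andP[_ hi].
  rewrite -sumEFin big_nat [RHS]big_nat; apply: eq_bigr => j /andP[_ hj].
  by rewrite /A hi hj -!EFinM.
have ln21 : ln 2 <= 1 :> R.
  have := @le_ln1Dx R 1; rewrite -[1 + 1]/(2 : R); apply.
  exact: (lt_trans (ltrN10 R) ltr01).
have E2 n : (\int[P0]_u \int[P0]_w (B n (idx n u) (idx n w))%:E <=
    (if (m.+2 <= n)%N then 5 * level_dot n v v else 0)%:E)%E.
  rewrite (integral_idx2 (fun n i => flow_ge0 n i fv) idx_lt midx Pidx n (B0 n)).
  under eq_bigr do (under eq_bigr do rewrite -!EFinM; rewrite sumEFin).
  rewrite sumEFin lee_fin /B; case: ifP => hn /=; last first.
    by rewrite big1// => i _; rewrite big1// => j _; rewrite !mulr0.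
  apply: le_trans (sum_close_le (2 ^ n) (fun i => flow_ge0 n i fv)).
  apply: ler_sum => i _; apply: ler_sum => j _.
  by rewrite ler_wpM2l ?mulr_ge0 ?flow_ge0// ler_piMl.
apply: lime_le; first by apply: is_cvg_nneseries => n _ _; do 2 (apply: integral_ge0 => ? _).
apply: nearW => N.
apply: (@le_trans _ _ (\sum_(0 <= n < N) (if (m.+2 <= n)%N then 5 * level_dot n v v else 0)%:E)%E).
  by apply: lee_sum => n _; exact: E2.
rewrite sumEFin lee_fin.
have L0 n : 0 <= level_dot n v v by exact: level_dot_ge0.
have -> : \sum_(0 <= n < N) (if (m.+2 <= n)%N then 5 * level_dot n v v else 0)
    = 5 * \sum_(m.+2 <= n < N) level_dot n v v.
  rewrite mulr_sumr; case: (leqP m.+2 N) => mN.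
    rewrite (big_cat_nat (leq0n _) mN)/= big_nat big1 ?add0r; last first.
      by move=> n /andP[_ hn]; rewrite leqNgt hn.
    by apply: eq_big_nat => n /andP[-> _].
  rewrite [RHS]big_geq ?(ltnW mN)// big_nat big1// => n /andP[_ hn].
  by rewrite leqNgt (ltn_trans hn mN).
have := tails N; have := level_dot_nonincr fv (leq_addl 2 m); rewrite add2n.
by lra.
Qed.

End FlowEnergy.

(** * Energy of a measure through its cell masses *)

Section LowerIntegral.
Context d (T : measurableType d) (R : realType) (mu : {measure set T -> \bar R}).
Local Open Scope ereal_scope.

(** Off the null set [f] is nonnegative, so its negative part is dominated by infinity on that set
    and has integral zero. *)
Lemma integral_ge_nneg (N : set T) (h f : T -> \bar R) :
  measurable N -> mu N = 0 -> measurable_fun setT h -> (forall x, 0 <= h x) ->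
  (forall x, ~ N x -> h x <= f x) -> \int[mu]_x h x <= \int[mu]_x f x.
Proof.
move=> mN N0 mh h0 hf.
have neg0 : \int[mu]_x f^\- x = 0.
  apply/eqP; rewrite eq_le integral_ge0// andbT.
  apply: (@le_trans _ _ (\int[mu]_x ((cst +oo) \_ N) x)).
    apply: nneg_le_integral => // x; rewrite patchE; case: ifPn => [_|]; first by rewrite leey.
    rewrite notin_setE => /hf hx; rewrite funenegE.
    by rewrite ge_max lexx andbT leeNl oppe0 (le_trans (h0 x)).
  by rewrite -integral_mkcond integral_cst// N0 mule0.
rewrite [leRHS]integralE neg0 sube0.
rewrite (ge0_negligible_integral mN measurableT mh (fun x _ => h0 x) N0) setTD integral_mkcond.
apply: nneg_le_integral => [x|x]; rewrite patchE; case: ifPn => // [|_].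
  by rewrite inE/= => hx; rewrite funeposE le_max hf.
exact: funepos_ge0.
Qed.

End LowerIntegral.

(** * The complement of the support is null *)

Section SupportNull.
Variable R : realType.
Variable mu : probability (R * R)%type R.

(** A point outside the support has a null ball around it, which contains a ball with dyadic centre
    and radius that still contains the point. There are only countably many of these. *)
Lemma negligible_msupportC : mu.-negligible (~` msupport mu).
Proof.
pose q (ijn : int * int * nat) : R * R :=
  (ijn.1.1%:~R / 2 ^+ ijn.2, ijn.1.2%:~R / 2 ^+ ijn.2).
pose b ijn := ball (q ijn) ((2 ^+ ijn.2)^-1 : R).
pose F k := if @unpickle (int * int * nat)%type k is Some ijn then
  (if mu (b ijn) == 0%E then b ijn else set0) else set0.
have F0 k : mu.-negligible (F k).
  rewrite /F; case: unpickle => [ijn|]; last exact: negligible_set0.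
  case: ifPn => [/eqP h|_]; last exact: negligible_set0.
  by exists (b ijn); split => //; exact: measurable_ball_prod.
apply: negligibleS (negligible_bigcup F0).
move=> z /= /existsNP[e /not_implyP[e0 he]].
have mu0 : mu (ball z e) = 0%E.
  by apply/eqP; rewrite eq_le measure_ge0 andbT leNgt; apply/negP.
(* Then [2^n > 2/e], so a ball of radius [2^-n] through [z] stays within distance [e] of [z]. *)
pose n := Num.truncn (2 / e).
have pn : (0 : R) < 2 ^+ n by rewrite exprn_gt0.
have en : 2 * (2 ^+ n)^-1 <= e.
  rewrite ler_pdivrMr// -ler_pdivrMl// mulrC.
  apply: (@le_trans _ _ n.+1%:R); first by rewrite ltW// truncnS_gt.
  by rewrite -natrX ler_nat ltn_expl.
pose ijn := (Num.floor (2 ^+ n * z.1), Num.floor (2 ^+ n * z.2), n).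
have close (x : R) : `|(Num.floor (2 ^+ n * x))%:~R / 2 ^+ n - x| < (2 ^+ n)^-1.
  have h1 := floor_le (2 ^+ n * x); have h2 := floorD1_gt (2 ^+ n * x).
  rewrite -(ltr_pM2l pn) divff ?gt_eqF//.
  rewrite -[X in X * _](@ger0_norm _ (2 ^+ n)) ?ltW// -normrM mulrBr mulrCA divff ?gt_eqF//.
  rewrite mulr1 ltr_norml; rewrite intrD in h2.
  by apply/andP; split; lra.
have qz : b ijn z by split; exact: close.
apply: (ex_intro2 _ _ (pickle ijn) I); rewrite /F pickleK.
have -> : mu (b ijn) == 0%E; last exact: qz.
rewrite eq_le measure_ge0 andbT -mu0; apply: le_measure; rewrite ?inE.
- exact: measurable_ball_prod.
- exact: measurable_ball_prod.
move=> w qw.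
apply: (@le_ball _ _ z (2 * (2 ^+ n)^-1) e en).
rewrite mulr_natl mulr2n; apply: ball_triangle qw.
exact: ball_sym.
Qed.

End SupportNull.

Section CellIndex.
Variable R : realType.

(** The minimum assigns the right endpoint 1 to the last cell. *)
Definition cell_index (n : nat) (z : R * R) : nat :=
  minn (Num.truncn (2 ^+ n * z.1)) (2 ^ n).-1.

Lemma cell_index_lt n z : (cell_index n z < 2 ^ n)%N.
Proof. by rewrite /cell_index; have := expn_gt0 2 n; lia. Qed.

Lemma cell_index_cdyadic n z : 0 <= z.1 <= 1 -> cdyadic n (cell_index n z) z.1.
Proof.
move=> /andP[z0 z1]; have p0 : (0 : R) < 2 ^+ n by rewrite exprn_gt0.
have y0 : 0 <= 2 ^+ n * z.1 by rewrite mulr_ge0// ltW.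
rewrite /cdyadic /cell_index/=; have /andP[h1 h2] := truncn_itv y0.
case: leqP => h; first by rewrite h1 natr1 ltW.
have hk : ((2 ^ n).-1.+1 = 2 ^ n)%N by rewrite prednK ?expn_gt0.
rewrite natr1 hk natrX; apply/andP; split; last by rewrite ler_piMr// ltW.
by apply: le_trans h1; rewrite ler_nat ltnW.
Qed.

Lemma measurable_cell_index n i : measurable [set z : R * R | cell_index n z = i].
Proof.
have mge k : measurable [set z : R * R | (k <= cell_index n z)%N].
  case: k => [|k]; first by rewrite (_ : [set _ | _] = setT)//; apply/seteqP; split.
  case: (ltnP k.+1 (2 ^ n)) => hk; last first.
    rewrite (_ : [set _ | _] = set0)//; apply/seteqP; split => // z /=.
    by have := cell_index_lt n z; lia.
  rewrite (_ : [set _ | _] = (fun z : R * R => 2 ^+ n * z.1) @^-1` `[k.+1%:R, +oo[); last first.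
    apply/seteqP; split => z; rewrite /= in_itv/= andbT /cell_index leq_min.
      move=> /andP[+ _]; case: (leP 0 (2 ^+ n * z.1)) => y0; first by rewrite truncn_ge_nat.
      by have /truncn0Pn -> : ~~ (1 <= 2 ^+ n * z.1) by rewrite -ltNge (lt_trans y0).
    move=> h; rewrite truncn_ge_nat ?h//=; last by rewrite (le_trans _ h).
    by have := expn_gt0 2 n; lia.
  rewrite -[X in measurable X]setTI.
  by apply: (measurable_funM (measurable_cst _) (@measurable_fst _ _ _ _)).
rewrite (_ : [set _ | _] = [set z | (i <= cell_index n z)%N] `\` [set z | (i.+1 <= cell_index n z)%N]).
  exact: measurableD.
apply/seteqP; split => z /=; last by move=> []; lia.
by move=> ->; split => //; rewrite ltnn.
Qed.

End CellIndex.

Definition cell_mass (R : realType) (mu : probability (R * R)%type R) (n i : nat) : R :=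
  fine (mu [set z | cell_index n z = i]).

Section LowerEnergy.
Variable R : realType.
Variable mu : probability (R * R)%type R.
Hypothesis mu_adm : admissible (real_axis `[0, 1]%classic) mu.

Local Notation w := (cell_mass mu).

Let wE n i : mu [set z | cell_index n z = i] = (w n i)%:E.
Proof. by rewrite /cell_mass fineK// fin_num_measure//; exact: measurable_cell_index. Qed.

Lemma cell_mass_ge0 n i : 0 <= w n i.
Proof. by rewrite -lee_fin -wE. Qed.

Lemma cell_mass_sum n : \sum_(0 <= i < 2 ^ n) w n i = 1.
Proof.
have := integral_idx (P0 := mu) (@cell_index_lt R)
  (@measurable_cell_index R) (fun n i _ => wE n i) n (h := fun _ => 1%E) (fun _ => lee01).
have -> : (\int[mu]_u (fun=> 1) (cell_index n u) = 1 :> \bar R)%E.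
  by rewrite integral_cst// mul1e; exact: probability_setT.
move=> /esym; by under eq_bigr do rewrite mule1; rewrite sumEFin => -[].
Qed.

(** The complement of the unit segment is null, and on the segment the kernel is at least its
    infimum over the pair of cells. *)
Lemma energy_ge_cells m :
  ((\sum_(0 <= i < 2 ^ m) \sum_(0 <= j < 2 ^ m)
     w m i * w m j * cell_kernel R m (ndist i j))%:E <= energy mu)%E.
Proof.
have [_ supp] := mu_adm.
pose D : set (R * R) := real_axis `[0, 1]%classic.
have mD : measurable D.
  rewrite (_ : D = `[0, 1]%classic `*` [set 0]); last by apply/seteqP; split => z [].
  exact: measurableX.
have mND : measurable (~` D) by exact: measurableC.
have ND0 : mu (~` D) = 0%E.
  apply: measure_negligible => //; apply: negligibleS (negligible_msupportC mu).
  exact: subsetC.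
pose g i j : R := if (i < 2 ^ m)%N && (j < 2 ^ m)%N
  then cell_kernel R m (ndist i j) else 0.
have g0 i j : (0 <= (g i j)%:E)%E.
  by rewrite lee_fin /g; case: ifP => // /andP[hi hj]; apply: cell_kernel_ge0; exact: ndist_lt.
have -> : (\sum_(0 <= i < 2 ^ m) \sum_(0 <= j < 2 ^ m)
     w m i * w m j * cell_kernel R m (ndist i j))%:E =
   (\int[mu]_z \int[mu]_y (g (cell_index m z) (cell_index m y))%:E)%E.
  rewrite (integral_idx2 cell_mass_ge0 (@cell_index_lt R) (@measurable_cell_index R)
    (fun n i _ => wE n i) m g0).
  rewrite -sumEFin big_nat [RHS]big_nat; apply: eq_bigr => i /andP[_ hi].
  rewrite -sumEFin big_nat [RHS]big_nat; apply: eq_bigr => j /andP[_ hj].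
  by rewrite /g hi hj -!EFinM.
have mg := @measurable_idx _ _ R (@cell_index R) (@cell_index_lt R) (@measurable_cell_index R) m.
rewrite /energy /interaction; apply: (integral_ge_nneg mND ND0).
- exact: (mg (fun i => (\int[mu]_y (g i (cell_index m y))%:E)%E)).
- by move=> z; exact: integral_ge0.
move=> z /contrapT Dz; apply: (integral_ge_nneg mND ND0) => //.
  exact: (mg (fun j => (g (cell_index m z) j)%:E)).
move=> y /contrapT Dy; rewrite /g !cell_index_lt/=.
move: Dz Dy; rewrite /D /real_axis/= !in_itv/= => -[z2 hz] [y2 hy].
have := logkernel_ge_cell (cell_index_cdyadic m hz) (cell_index_cdyadic m hy).
by move: z2 y2; case: z {hz} => a b; case: y {hy} => a' b' /= -> ->.
Qed.

End LowerEnergy.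

(** * Comparison of the two capacities *)

Section Capacity.
Variable R : realType.

(** At distance at least [M] the error is at most [2/M]. Nearer the diagonal it is at most
    [17 = 2 + 15], while the kernel is at least [m ln 2 - ln M]: Markov's inequality lets the energy
    pay for the mass near the diagonal. *)
Lemma cell_error_bound m M d : (0 < M)%N -> (M <= 2 ^ m)%N -> (d < 2 ^ m)%N ->
  0 < m%:R * ln 2 - ln M%:R :> R ->
  cell_error R d + 15 * (d == 0%N)%:R <=
  2 / M%:R + 17 / (m%:R * ln 2 - ln M%:R) * cell_kernel R m d.
Proof.
move=> M0 Mm dm L0; have k0 := @cell_kernel_ge0 R m d dm.
have M0' : (0 : R) < M%:R by rewrite ltr0n.
case: (leqP M d) => Md.
  have d0 : (0 < d)%N by exact: leq_trans Md.
  rewrite /cell_error -if_neg -lt0n d0 (gtn_eqF d0) mulr0 addr0.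
  apply: (@le_trans _ _ (2 / M%:R)).
    by rewrite ler_pM2l// lef_pV2 ?posrE ?ltr0n// ler_nat.
  by rewrite lerDl mulr_ge0// divr_ge0// ltW.
apply: (@le_trans _ _ 17).
  rewrite /cell_error; case: eqP => [_|/eqP dn]; first by rewrite mulr1; lra.
  have : 2 / d%:R <= 2 :> R.
    by rewrite ler_pdivrMr ?ltr0n ?lt0n// ler_peMr// ler1n lt0n.
  by rewrite mulr0; lra.
have kL : m%:R * ln 2 - ln M%:R <= cell_kernel R m d.
  by rewrite /cell_kernel lerD2l lerN2 ler_ln ?posrE ?ltr0n// ler_nat.
apply: (@le_trans _ _ (17 / (m%:R * ln 2 - ln M%:R) * (m%:R * ln 2 - ln M%:R))).
  by rewrite divfK ?gt_eqF.
rewrite -[leLHS]add0r; apply: lerD; first by rewrite divr_ge0.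
by apply: ler_wpM2l => //; rewrite divr_ge0// ltW.
Qed.

Lemma finite_energy_interval : exists2 nu : probability (R * R)%type R,
  admissible (real_axis `[0, 1]%classic) nu & (energy nu < +oo)%E.
Proof.
(* The uniform law on [[1/4, 1/2]], the second quarter of the root cell, fits [flow_energy] with
   [m = 0]. *)
pose v : nat -> nat -> R := unit_flow 2 1.
have fv : flow v by exact: unit_flow_flow.
have uv : uniform_below 2 v by exact: unit_flow_uniform.
have v4 i : v 2%N i != 0 -> exists j, i = (4 * j + 1)%N.
  rewrite /v /unit_flow leqnn subnn expn0 divn1; case: (eqVneq 1%N i) => [<- _|_].
    by exists 0%N.
  by rewrite eqxx.
have tails N : \sum_(2 <= n < N) level_dot n v v <= 3 * level_dot 2 v v.
  have L0 n : 0 <= level_dot n v v by exact: level_dot_ge0.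
  case: (leqP 2 N) => hN; last by rewrite big_geq ?(ltnW hN)// mulr_ge0.
  have := tree_energy_uniform uv fv (leqnn 2) hN.
  rewrite /tree_energy [in RHS]big_geq// add0r => h.
  by have := L0 N; have := L0 2%N; lra.
have ch k : exists t, charges_in t v ((fun=> `[0, 1]%classic) (k : nat)).
  exists 0%N => b; case: (ltnP b (2 ^ 0)) => hb; last by rewrite (flow_out fv hb) eqxx.
  move: hb; rewrite expn0 ltnS leqn0 => /eqP -> _ x.
  by rewrite cdyadicE expr0 !divr1 add0r.
have [nu adm En] := flow_energy (m := 0) fv v4 tails ch.
exists nu; last by apply: le_lt_trans En _; rewrite ltry.
move: adm; congr (admissible (real_axis _) nu).
by apply/seteqP; split => [x /(_ 0%N)|x h k].
Qed.

Lemma Cap_interval_gt0 : (0 < Cap (real_axis (`[0%R, 1%R]%classic : set R)))%E.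
Proof.
have [nu adm En] := finite_energy_interval.
rewrite /Cap; apply: expeR_gt0; rewrite lteNr/=; apply: le_lt_trans En.
by apply: ereal_inf_lbound; exists nu.
Qed.

Variables (lambda : R) (c : nat -> R).
Hypotheses (lambda_gt0 : 0 < lambda) (spread : well_spread c) (c01 : forall k, 0 <= c k <= 1).

(** The lengths of the [I_k] tend to 0, so points of [S] are limits of centres, and [[0, 1]] is
    closed. *)
Lemma limsup_set_sub : limsup_set lambda c `<=` `[0, 1]%classic.
Proof.
move=> x hx; have small e : 0 < e -> exists k, `|x - c k| < e.
  move=> e0; pose m := Num.truncn (e^-1 / lambda).
  have [k mk hk] := hx m; exists k; apply: (lt_trans hk).
  have h1 : e^-1 < lambda * k.+1%:R.
    rewrite mulrC -ltr_pdivrMr//; apply: (lt_le_trans (truncnS_gt _)).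
    by rewrite ler_nat.
  have h2 : expR (- (lambda * k.+1%:R)) < e.
    rewrite expRN -[e]invrK ltf_pV2 ?posrE ?invr_gt0 ?expR_gt0//.
    apply: (lt_trans h1); apply: lt_le_trans (expR_ge1Dx _).
    by rewrite ltrDr.
  by have := expR_gt0 (- (lambda * k.+1%:R)); lra.
rewrite /= in_itv/=; apply/andP; split.
  apply/ler_addgt0Pr => e /small[k]; have /andP[] := c01 k.
  by rewrite ltr_norml => h1 h2 /andP[h3 h4]; lra.
apply/ler_addgt0Pr => e /small[k]; have /andP[] := c01 k.
by rewrite ltr_norml => h1 h2 /andP[h3 h4]; lra.
Qed.

(** The cell masses of [mu] at a deep level [m] are moved to second quarters and pushed into [S] by
    [limit_flow]. The same sum of [cell_kernel] bounds the energy of [mu] from below and, up to the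
    cell errors, that of [nu] from above. *)
Lemma near_optimal (mu : probability (R * R)%type R) (e : R) :
  admissible (real_axis `[0, 1]%classic) mu -> 0 < e -> (energy mu < +oo)%E ->
  exists2 nu, admissible (real_axis (limsup_set lambda c)) nu &
    (energy nu <= energy mu + e%:E)%E.
Proof.
move=> adm e0 Efin.
set w := cell_mass mu.
have w0 : forall n i, 0 <= w n i := cell_mass_ge0 mu.
have w1 : forall n, \sum_(0 <= i < 2 ^ n) w n i = 1 := cell_mass_sum mu.
have low := energy_ge_cells adm; rewrite -/w in low.
have sum_ge0 m : 0 <= \sum_(0 <= i < 2 ^ m) \sum_(0 <= j < 2 ^ m)
    w m i * w m j * cell_kernel R m (ndist i j).
  rewrite big_nat sumr_ge0// => i /andP[_ hi]; rewrite big_nat sumr_ge0// => j /andP[_ hj].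
  by rewrite !mulr_ge0 ?w0// cell_kernel_ge0// ndist_lt.
have E0 : (0 <= energy mu)%E by rewrite (le_trans _ (low 0%N))// lee_fin.
have EE : energy mu = (fine (energy mu))%:E by rewrite fineK// ge0_fin_numE.
set E : R := fine (energy mu) in EE.
have E0' : 0 <= E by rewrite -lee_fin -EE.
have [M' hM] := @ex_nat_div_le R 2 (e / 2) (divr_gt0 e0 (ltr0n _ 2)).
pose M := M'.+1; have M0 : (0 < M)%N by [].
have l2 := ln2_gt0 R.
(* This gives [L >= 34 E / e + 1], hence a near-diagonal error [17 E / L] of at most [e/2]; the
   other half of [e] covers [2/M]. *)
pose m := maxn M (Num.truncn ((ln M%:R + 34 * E / e + 1) / ln 2)).+1.
have hm : ln M%:R + 34 * E / e + 1 <= m%:R * ln 2.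
  rewrite -ler_pdivrMr//; apply: (le_trans (ltW (truncnS_gt _))).
  by rewrite ler_nat leq_maxr.
have Mm : (M <= 2 ^ m)%N by apply: (leq_trans (leq_maxl M _)); exact: ltnW (ltn_expl _ _).
pose L : R := m%:R * ln 2 - ln M%:R.
have Ee0 : 0 <= 34 * E / e by rewrite divr_ge0 ?mulr_ge0// ltW.
have L0 : 0 < L by rewrite /L; lra.
have EL : 17 / L * E <= e / 2.
  rewrite mulrAC ler_pdivrMr//.
  have : 34 * E <= e * L.
    have h : 34 * E / e <= L by rewrite /L; lra.
    by rewrite [e * L]mulrC -ler_pdivrMr.
  lra.
(* The mass of each cell is spread evenly over its second quarter. *)
pose v0 n i := \sum_(a <- index_iota 0 (2 ^ m)) w m a * (unit_flow m.+2 (4 * a + 1) n i : R).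
have fv0 : flow v0.
  apply: flow_comb => // a; rewrite mem_index_iota => /andP[_ ha].
  by apply: unit_flow_flow; exact: quarter_lt.
have v0m i : v0 m i = if (i < 2 ^ m)%N then w m i else 0.
  have E1 a : unit_flow m.+2 (4 * a + 1) m i = (a == i)%:R :> R.
    rewrite /unit_flow (leq_trans (leqnSn m) (leqnSn _)).
    have -> : (m.+2 - m = 2)%N by rewrite -[m.+2]addn2 addKn.
    by rewrite mulnC divnMDl// addn0.
  rewrite /v0; under eq_bigr do rewrite E1.
  case: (ltnP i (2 ^ m)) => hi.
    rewrite (bigD1_seq i) ?mem_index_iota ?iota_uniq//= eqxx mulr1 big1 ?addr0//.
    by move=> a ai; rewrite (negbTE ai) mulr0.
  rewrite big_nat big1// => a /andP[_ ha]; case: eqP => [ai|]; last by rewrite mulr0.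
  by move: ha; rewrite ai ltnNge hi.
have v04 i : v0 m.+2 i != 0 -> exists j, i = (4 * j + 1)%N.
  move=> vi; apply: contrapT => hn; move/eqP: vi; apply.
  rewrite /v0 big1// => a _; rewrite /unit_flow leqnn subnn expn0 divn1.
  by case: eqP => [e1|_]; [exfalso; apply: hn; exists a|rewrite mulr0].
have [v [fv vv0 ch tails]] := limit_flow lambda_gt0 spread m.+2 fv0.
have vm i : v m i = if (i < 2 ^ m)%N then w m i else 0.
  by rewrite -v0m; apply: (flow_eq_coarse fv fv0 vv0); rewrite ltnW.
have dot2 : level_dot m.+2 v0 v0 = level_dot m.+2 v v.
  by apply: eq_bigr => i _; rewrite vv0.
rewrite dot2 in tails.
have v4 i : v m.+2 i != 0 -> exists j, i = (4 * j + 1)%N by rewrite vv0; exact: v04.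
have [nu admnu Enu] := flow_energy fv v4 tails ch.
(* The intersection of all [tail_cover lambda c k] is [limsup_set lambda c] by definition. *)
exists nu; first exact: admnu.
apply: (le_trans Enu).
have lowm := low m; rewrite EE lee_fin in lowm.
rewrite EE -EFinD lee_fin.
pose S (F : nat -> nat -> R) := \sum_(0 <= i < 2 ^ m) \sum_(0 <= j < 2 ^ m) w m i * w m j * F i j.
have SD F G : S (fun i j => F i j + G i j) = S F + S G.
  rewrite /S -big_split; apply: eq_bigr => i _; rewrite -big_split; apply: eq_bigr => j _.
  by rewrite /= mulrDr.
have SZ a F : S (fun i j => a * F i j) = a * S F.
  rewrite /S mulr_sumr; apply: eq_bigr => i _; rewrite mulr_sumr; apply: eq_bigr => j _.
  by rewrite mulrCA.
have S1 : S (fun _ _ => 1) = 1.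
  rewrite /S; under eq_bigr do (under eq_bigr do rewrite mulr1; rewrite -mulr_sumr w1 mulr1).
  exact: w1.
have -> : \sum_(0 <= i < 2 ^ m) \sum_(0 <= j < 2 ^ m) v m i * v m j *
    (cell_kernel R m (ndist i j) + cell_error R (ndist i j)) =
    S (fun i j => cell_kernel R m (ndist i j)) + S (fun i j => cell_error R (ndist i j)).
  rewrite -SD; rewrite /S big_nat [RHS]big_nat; apply: eq_bigr => i /andP[_ hi].
  by rewrite big_nat [RHS]big_nat; apply: eq_bigr => j /andP[_ hj]; rewrite !vm hi hj.
have -> : level_dot m v v = S (fun i j => (ndist i j == 0%N)%:R).
  rewrite /level_dot /S big_nat [RHS]big_nat; apply: eq_bigr => i /andP[_ hi].
  rewrite !vm hi (bigD1_seq i) ?mem_index_iota ?iota_uniq//= big1 ?addr0.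
    by rewrite /ndist subnn eqxx mulr1.
  by move=> j ji; rewrite ndist_eq0 eq_sym (negbTE ji) mulr0.
have : S (fun i j => cell_error R (ndist i j)) + 15 * S (fun i j => (ndist i j == 0%N)%:R)
    <= 2 / M%:R + 17 / L * S (fun i j => cell_kernel R m (ndist i j)).
  have e1 : 2 / M%:R = S (fun _ _ => 2 / M%:R * 1) by rewrite SZ S1 mulr1.
  rewrite [X in _ <= X + _]e1 -!SZ -!SD.
  rewrite /S big_nat [leRHS]big_nat; apply: ler_sum => i /andP[_ hi].
  rewrite big_nat [leRHS]big_nat; apply: ler_sum => j /andP[_ hj].
  rewrite ler_wpM2l ?mulr_ge0 ?w0// mulr1; apply: cell_error_bound => //.
  exact: ndist_lt.
rewrite -/(S (fun i j => cell_kernel R m (ndist i j))) in lowm.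
have LS : 17 / L * S (fun i j => cell_kernel R m (ndist i j)) <= 17 / L * E.
  by rewrite ler_wpM2l// divr_ge0// ltW.
by move: hM; rewrite -/M; lra.
Qed.

Lemma Cap_limsup : Cap (real_axis (limsup_set lambda c)) = Cap (real_axis `[0, 1]%classic).
Proof.
rewrite /Cap; congr (expeR (- _)); apply/eqP; rewrite eq_le; apply/andP; split.
  apply: le_ereal_inf_tmp => _ [mu adm <-].
  have [->|Efin] := eqVneq (energy mu) +oo%E; first by rewrite leey.
  have {}Efin : (energy mu < +oo)%E by rewrite ltey.
  apply/lee_addgt0Pr => e e0.
  have [nu admnu Enu] := near_optimal adm e0 Efin.
  by apply: le_trans Enu; apply: ereal_inf_lbound; exists nu.
apply: ereal_inf_le_tmp => _ [mu [cmu smu] <-]; exists mu => //; split => //.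
by move=> z /smu [z2 z1]; split => //; exact: limsup_set_sub.
Qed.

End Capacity.

(** * Hitting probabilities *)

Section Dyadic.
Variable R : realType.
Local Notation leb := (@lebesgue_measure R).

(** [h] is the length of a cell, [beta] that of its part with density below [delta], [p] the chance
    of a hit. First [(1 - p)^T <= 1 / (1 + T p)]; with [y = beta / h] and [s = T delta h] this is at
    most [1 / (1 + s (1 - y))], which is below [y + 1 / (1 + s)]. *)
Lemma miss_bound (p delta h beta : R) (T : nat) : 0 < h -> 0 <= beta <= h -> 0 <= delta ->
  delta * (h - beta) <= p <= 1 ->
  (1 - p) ^+ T <= beta / h + (1 + T%:R * delta * h)^-1.
Proof.
move=> h0 /andP[b0 bh] d0 /andP[dp p1].
have p0 : 0 <= p by apply: le_trans dp; rewrite mulr_ge0// subr_ge0.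
have bern : (1 - p) ^+ T * (1 + T%:R * p) <= 1.
  elim: T => [|T IH]; first by rewrite expr0 mul0r addr0 mulr1.
  apply: le_trans IH; rewrite exprS -natr1.
  have : 0 <= (1 - p) ^+ T by rewrite exprn_ge0// subr_ge0.
  have : (0 : R) <= T%:R by []; move: (T%:R : R) ((1 - p) ^+ T) => t z t0 z0.
  have -> : (1 - p) * z * (1 + (t + 1) * p) = z * (1 + t * p - (t + 1) * p ^+ 2) by ring.
  by rewrite ler_wpM2l// gerBl mulr_ge0 ?addr_ge0// sqr_ge0.
pose y := beta / h; pose s := T%:R * delta * h.
have y0 : 0 <= y by rewrite divr_ge0// ltW.
have y1 : y <= 1 by rewrite ler_pdivrMr// mul1r.
have s0 : 0 <= s by rewrite !mulr_ge0// ltW.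
have yh : beta = y * h by rewrite divfK// gt_eqF.
have spy : s * (1 - y) <= T%:R * p.
  have -> : s * (1 - y) = T%:R * (delta * (h - beta)) by rewrite yh /s; ring.
  by rewrite ler_wpM2l.
rewrite -/y -/s.
have s1 : 0 < 1 + s by lra.
have t0 : 0 < 1 + T%:R * p by rewrite ltr_pwDl// mulr_ge0.
have q0 : 0 < 1 + s * (1 - y) by rewrite ltr_pwDl// mulr_ge0// subr_ge0.
apply: (@le_trans _ _ (1 + T%:R * p)^-1).
  by rewrite -[leRHS]div1r ler_pdivlMr.
apply: (@le_trans _ _ (1 + s * (1 - y))^-1).
  by rewrite lef_pV2 ?posrE// lerD2l.
rewrite -[leLHS]div1r ler_pdivrMr//.
have -> : y + (1 + s)^-1 = (y * (1 + s) + 1) / (1 + s) by field; rewrite gt_eqF.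
rewrite mulrAC ler_pdivlMr// mul1r.
have : 0 <= s * (1 - y) * (y * (1 + s)).
  by apply: mulr_ge0; apply: mulr_ge0; rewrite ?subr_ge0 ?(ltW s1).
by nra.
Qed.

Lemma dyadicE n b : dyadic n b = `[b%:R / 2 ^+ n, (b%:R + 1) / 2 ^+ n[%classic :> set R.
Proof.
have p0 : (0 : R) < 2 ^+ n by rewrite exprn_gt0.
apply/seteqP; split => x; rewrite /dyadic/= in_itv/= => /andP[h1 h2].
  by rewrite ler_pdivrMr// ltr_pdivlMr// mulrC h1 h2.
by move: h1 h2; rewrite ler_pdivrMr// ltr_pdivlMr// mulrC => -> ->.
Qed.

Lemma measurable_dyadic n b : measurable (dyadic n b : set R).
Proof. by rewrite dyadicE. Qed.

Lemma lebesgue_dyadic n b : leb (dyadic n b) = ((2 ^+ n)^-1)%:E.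
Proof.
have p0 : (0 : R) < 2 ^+ n by rewrite exprn_gt0.
rewrite dyadicE lebesgue_measure_itv/= lte_fin ltr_pM2r ?invr_gt0// ltrDl ltr01.
by rewrite -EFinB mulrDl addrAC subrr add0r mul1r.
Qed.

Lemma dyadic_sub01 n b : (b < 2 ^ n)%N -> dyadic n b `<=` (`[0, 1]%classic : set R).
Proof.
move=> hb x hx; rewrite /= in_itv/= (dyadic_ge0 hx)/=.
have p0 : (0 : R) < 2 ^+ n by rewrite exprn_gt0.
move: hx; rewrite /dyadic/= => /andP[_ h].
rewrite -(ler_pM2l p0) mulr1 (le_trans (ltW h))//.
by rewrite natr1 -natrX ler_nat.
Qed.

Lemma dyadic_inj n b b' (x : R) : dyadic n b x -> dyadic n b' x -> b = b'.
Proof.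
rewrite /dyadic/= => /andP[h1 h2] /andP[h3 h4].
have a : (b < b'.+1)%N by rewrite -(ltr_nat R) -(natr1 b') (le_lt_trans h1).
have a' : (b' < b.+1)%N by rewrite -(ltr_nat R) -(natr1 b) (le_lt_trans h3).
by lia.
Qed.

Lemma sum_dyadic_le n b0 K (B : set R) : measurable B ->
  (\sum_(0 <= j < K) leb (dyadic n (b0 + j) `&` B) <= leb B)%E.
Proof.
move=> mB; pose F j := dyadic n (b0 + j) `&` B.
have mF j : measurable (F j) by apply: measurableI => //; exact: measurable_dyadic.
have tF : trivIset setT F.
  apply/trivIsetP => i j _ _ ij; apply/seteqP; split => // x [[xi _] [xj _]].
  by move/eqP: ij; apply; have := dyadic_inj xi xj; lia.
rewrite big_mkord -(measure_bigsetU leb mF tF); apply: le_measure; rewrite ?inE//.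
  by apply: bigsetU_measurable => j _; exact: mF.
by rewrite -bigcup_mkord => x [j _ []].
Qed.

End Dyadic.

Section HitProbability.
Variable (R : realType) (d : measure_display) (Omega : measurableType d)
  (P : probability Omega R) (c : nat -> Omega -> R) (f : R -> R).
Hypothesis mc : forall k, measurable_fun setT (c k).
Hypothesis indep : mutually_independent P c.
Hypothesis mf : measurable_fun setT f.
Hypothesis f0 : forall x, 0 <= f x.
Hypothesis fpos : {ae (@lebesgue_measure R), forall x, `[0, 1]%classic x -> 0 < f x}.
Hypothesis law : forall k (B : set R), measurable B ->
  P (c k @^-1` B) = (\int[lebesgue_measure]_(x in B `&` `[0%R, 1%R]%classic) (f x)%:E)%E.
Local Notation leb := (@lebesgue_measure R).

(** The centres share one law, so the hitting probability of the first serves for all. *)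
Let hitp n b := fine (P (c 0%N @^-1` dyadic n b)).

Let mpre k (B : set R) : measurable B -> measurable (c k @^-1` B).
Proof. by move=> mB; rewrite -[_ @^-1` _]setTI; exact: mc. Qed.

Let hitpE k n b : P (c k @^-1` dyadic n b) = (hitp n b)%:E.
Proof.
rewrite /hitp fineK ?fin_num_measure//; last by apply: mpre; exact: measurable_dyadic.
by rewrite !law//; exact: measurable_dyadic.
Qed.

Let low r : set R := `[0, 1]%classic `&` [set x | f x < r.+1%:R^-1].

Let mlow r : measurable (low r).
Proof.
apply: measurableI => //.
have := mf measurableT (measurable_itv `]-oo, r.+1%:R^-1[).
by rewrite setTI; congr measurable; apply/seteqP; split => x; rewrite /= in_itv.
Qed.

Let low_fin r : (leb (low r) < +oo)%E.
Proof.
apply: (@le_lt_trans _ _ (leb `[0%R, 1%R]%classic)).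
  by apply: le_measure; rewrite ?inE; [exact: mlow|exact: measurable_itv|move=> x []].
by rewrite lebesgue_measure_itv/= lte_fin ltr01 ltry.
Qed.

(** The sets [low r] have finite measure and decrease to the zero set of the density in [[0, 1]],
    which is null. *)
Lemma small_low (e : R) : 0 < e -> exists r, (leb (low r) < e%:E)%E.
Proof.
move=> e0; apply: contrapT => hn.
have ge r : (e%:E <= leb (low r))%E by rewrite leNgt; apply/negP => h; apply: hn; exists r.
have mcap : measurable (\bigcap_r low r) by exact: bigcapT_measurable.
have cvg : (leb \o low) @ \oo --> leb (\bigcap_r low r).
  apply: nonincreasing_cvg_mu; [exact: low_fin|exact: mlow|exact: mcap|].
  move=> n m nm; apply/subsetPset => x [x01 /= fx].
  split => //=; apply: lt_le_trans fx _.
  by rewrite lef_pV2 ?posrE// ler_nat.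
have cap0 : leb (\bigcap_r low r) = 0%E.
  apply: measure_negligible => //; move: fpos => /= [N [mN N0 hN]].
  exists N; split => //; apply: subset_trans hN => x hx /= h.
  have [x01 _] := hx 0%N I.
  have fx := h x01.
  have [r hr] := ex_nat_div_le 1 fx.
  by have [_ /=] := hx r I; rewrite -div1r ltNge hr.
have : (e%:E <= limn (leb \o low))%E.
  by apply: lime_ge; [apply/cvg_ex; eexists; exact: cvg|exact: nearW].
by rewrite (cvg_lim _ cvg)// cap0 lee_fin leNgt e0.
Qed.

Lemma hitp_ge n b r : (b < 2 ^ n)%N ->
  r.+1%:R^-1 * ((2 ^+ n)^-1 - fine (leb (dyadic n b `&` low r))) <= hitp n b.
Proof.
move=> hb; set q := dyadic n b; have mq : measurable q by exact: measurable_dyadic.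
have ml := mlow r.
have fin : leb (q `&` low r) = (fine (leb (q `&` low r)))%:E.
  rewrite fineK// ge0_fin_numE//; apply: le_lt_trans (low_fin r).
  by apply: le_measure; rewrite ?inE;
    [exact: measurableI|exact: mlow|exact: subIsetr].
rewrite -lee_fin -(hitpE 0) law// EFinM EFinB -fin -(lebesgue_dyadic R n b) -/q.
have mql : measurable (q `\` low r) by exact: measurableD.
have q01 : q `<=` `[0%R, 1%R]%classic by exact: dyadic_sub01.
have fq : (leb q < +oo)%E by rewrite lebesgue_dyadic ltry.
rewrite -(@measureD _ _ _ leb _ _ mq ml fq).
rewrite -integral_cst//.
apply: (@le_trans _ _ (\int[leb]_(x in q `\` low r) (f x)%:E)%E).
  apply: ge0_le_integral => //.
  - by move=> x _; rewrite lee_fin invr_ge0.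
  - by apply/measurable_EFinP; exact: measurable_funTS.
  - move=> x [qx nx]; rewrite lee_fin leNgt; apply/negP => fx; apply: nx.
    by split => //; exact: q01.
apply: ge0_subset_integral => //.
- exact: measurableI.
- by apply/measurable_EFinP; exact: measurable_funTS.
- by move=> x _; rewrite lee_fin.
- by move=> x [qx _]; split => //; exact: q01.
Qed.

Lemma hitp_le1 n b : hitp n b <= 1.
Proof.
rewrite -lee_fin -(hitpE 0); apply: probability_le1.
by apply: mpre; exact: measurable_dyadic.
Qed.

(** In [miss_bound], the low-density parts sum to at most half of the bound by the choice of [r],
    and the second summands are at most [tau / 2] each by the choice of [L]. Neither choice involves
    [N]. *)
Lemma sum_miss_le m a (tau : R) : (a < 2 ^ m)%N -> 0 < tau -> exists L, forall N,
  \sum_(0 <= j < 2 ^ N) (1 - hitp (m + N) (a * 2 ^ N + j)) ^+ (L * 2 ^ N) <= tau * 2 ^+ N.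
Proof.
move=> am tau0.
have pm : (0 : R) < 2 ^+ m by rewrite exprn_gt0.
have [r hr] := @small_low (tau / 2 / 2 ^+ m) (divr_gt0 (divr_gt0 tau0 (ltr0n _ 2)) pm).
set B := low r in hr; have mB : measurable B := mlow r; set delta : R := r.+1%:R^-1.
have dl0 : 0 < delta by rewrite invr_gt0.
have [L' hL] := @ex_nat_div_le R (2 ^+ m / delta) (tau / 2) (divr_gt0 tau0 (ltr0n _ 2)).
exists L'.+1 => N.
have pN : (0 : R) < 2 ^+ N by rewrite exprn_gt0.
pose h : R := (2 ^+ (m + N))^-1.
have h0 : 0 < h by rewrite invr_gt0 exprn_gt0.
pose beta j := fine (leb (dyadic (m + N) (a * 2 ^ N + j) `&` B)).
have betafin j : leb (dyadic (m + N) (a * 2 ^ N + j) `&` B) = (beta j)%:E.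
  rewrite fineK// ge0_fin_numE//; apply: le_lt_trans (low_fin r).
  by apply: le_measure; rewrite ?inE;
    [apply: measurableI => //; exact: measurable_dyadic|exact: mlow|exact: subIsetr].
have beta0 j : 0 <= beta j by rewrite -lee_fin -betafin.
have betah j : beta j <= h.
  rewrite -lee_fin -betafin -(lebesgue_dyadic R (m + N) (a * 2 ^ N + j)).
  by apply: le_measure; rewrite ?inE;
    [apply: measurableI => //; exact: measurable_dyadic|exact: measurable_dyadic|exact: subIsetl].
have sbeta : \sum_(0 <= j < 2 ^ N) beta j <= tau / 2 / 2 ^+ m.
  rewrite -lee_fin -sumEFin; under eq_bigr do rewrite -betafin.
  by apply: le_trans (ltW hr); exact: sum_dyadic_le.
apply: (@le_trans _ _ (\sum_(0 <= j < 2 ^ N) (beta j / h + tau / 2))).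
  apply: ler_sum_nat => j /andP[_ hj].
  apply: (le_trans (@miss_bound R _ delta h (beta j) _ h0 _ (ltW dl0) _)).
  - by rewrite beta0 betah.
  - rewrite hitp_le1 andbT; apply: hitp_ge; rewrite expnD.
    by have := expn_gt0 2 N; nia.
  rewrite lerD2l.
  have e1 : (L'.+1 * 2 ^ N)%:R * delta * h = L'.+1%:R * (delta / 2 ^+ m).
    by rewrite /h exprD natrM natrX; field; rewrite !gt_eqF.
  rewrite e1; apply: le_trans hL.
  rewrite -[leRHS]invrK lef_pV2 ?posrE; last 2 first.
  - by rewrite ltr_pwDl// mulr_ge0// divr_ge0// ltW.
  - by rewrite invr_gt0 !divr_gt0.
  have -> : (2 ^+ m / delta / L'.+1%:R)^-1 = L'.+1%:R * (delta / 2 ^+ m).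
    by rewrite !invfM !invrK mulrC [X in _ * X = _]mulrC.
  by rewrite lerDr.
rewrite big_split/= -mulr_suml sumr_const_nat subn0 -[(tau / 2) *+ _]mulr_natl natrX.
apply: (@le_trans _ _ (tau / 2 / 2 ^+ m / h + 2 ^+ N * (tau / 2))).
  by rewrite lerD2r ler_pM2r ?invr_gt0.
rewrite /h invrK exprD le_eqVlt; apply/orP; left; apply/eqP.
by field; rewrite gt_eqF.
Qed.

Let unhit n b k0 k1 : set Omega :=
  \bigcap_(k in [set` index_iota k0 k1]) c k @^-1` (~` dyadic n b).

Let unhitE n b k0 k1 w : unhit n b k0 k1 w <-> ~ hit (c^~ w) n b k0 k1.
Proof.
split=> [h [k hk hd]|h k /= hk hd].
  by apply: (h k) hd; rewrite /= mem_index_iota.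
by apply: h; exists k => //; rewrite mem_index_iota in hk.
Qed.

Let munhit n b k0 k1 : measurable (unhit n b k0 k1).
Proof.
rewrite /unhit bigcap_seq; apply: bigsetI_measurable => k _.
by apply: mpre; apply: measurableC; exact: measurable_dyadic.
Qed.

Let Punhit n b k0 k1 : P (unhit n b k0 k1) = ((1 - hitp n b) ^+ (k1 - k0))%:E.
Proof.
rewrite /unhit bigcap_seq (indep (B := fun=> ~` dyadic n b)) ?iota_uniq//; last first.
  by move=> i _; apply: measurableC; exact: measurable_dyadic.
have PC k : P (c k @^-1` (~` dyadic n b)) = (1 - hitp n b)%:E.
  rewrite preimage_setC probability_setC; first by rewrite hitpE -EFinB.
  by apply: (@mpre k (dyadic n b)); exact: measurable_dyadic.
under eq_bigr do rewrite PC.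
by rewrite prodEFin prodr_const_nat.
Qed.

(** The failure of the inequality of [well_spread] at a single scale. *)
Definition crowded m a p N L : set Omega :=
  [set w | (2 ^ N < missed (c^~ w) m a N L * p.+2)%N].

Let U m a N L j := unhit (m + N) (a * 2 ^ N + j) (2 ^ N) (L.+1 * 2 ^ N).

Let missedE m a N L w : (missed (c^~ w) m a N L)%:R =
  \sum_(0 <= j < 2 ^ N) \1_(U m a N L j) w :> R.
Proof.
rewrite /missed natr_sum; apply: eq_bigr => j _; rewrite indicE.
congr ((nat_of_bool _)%:R); apply/idP/idP => [/asboolPn h|].
  by rewrite inE; apply/unhitE.
by rewrite inE => /unhitE h; apply/asboolPn.
Qed.

Lemma measurable_crowded m a p N L : measurable (crowded m a p N L).
Proof.
have mS : measurable_fun setT (fun w => \sum_(0 <= j < 2 ^ N) (\1_(U m a N L j) w : R)).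
  by apply: measurable_sum => j; apply: measurable_indic; exact: munhit.
have mS' := measurable_funM mS (@measurable_cst _ _ _ _ setT (p.+2%:R : R)).
have := mS' measurableT _ (measurable_itv `](2 ^ N)%:R, +oo[).
rewrite setTI; congr measurable; apply/seteqP; split => w; rewrite /crowded/= in_itv/= andbT -missedE.
  by rewrite -natrM ltr_nat.
by rewrite -natrM ltr_nat.
Qed.

(** Markov's inequality for the number of missed cells, whose mean is at most [kappa 2^N / (p+2)] by
    independence and [sum_miss_le]. *)
Lemma crowded_small m a p (kappa : R) : (a < 2 ^ m)%N -> 0 < kappa ->
  exists L, forall N, (P (crowded m a p N L) <= kappa%:E)%E.
Proof.
move=> am k0.
have kp0 : 0 < kappa / p.+2%:R by rewrite divr_gt0.
have [L hL] := sum_miss_le am kp0.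
exists L => N; have pN : (0 : R) < 2 ^+ N by rewrite exprn_gt0.
have step : ((2 ^+ N)%:E * P (crowded m a p N L) <=
    (p.+2%:R)%:E * \sum_(0 <= j < 2 ^ N) P (U m a N L j))%E.
  have e1 : ((2 ^+ N)%:E * P (crowded m a p N L) =
      \int[P]_w ((2 ^+ N)%:E * (\1_(crowded m a p N L) w)%:E))%E.
    rewrite ge0_integralZl//; last exact/measurable_EFinP/measurable_indic/measurable_crowded.
    by rewrite integral_indic ?setIT//; exact: measurable_crowded.
  have e2 : ((p.+2%:R)%:E * \sum_(0 <= j < 2 ^ N) P (U m a N L j) =
      \int[P]_w ((p.+2%:R)%:E * \sum_(0 <= j < 2 ^ N) (\1_(U m a N L j) w)%:E))%E.
    rewrite ge0_integralZl//; last 2 first.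
    - by apply: emeasurable_sum => j; exact/measurable_EFinP/measurable_indic/munhit.
    - by move=> w _; apply: sume_ge0.
    rewrite ge0_integral_sum//; last first.
      by move=> j; exact/measurable_EFinP/measurable_indic/munhit.
    by congr (_ * _)%E; apply: eq_bigr => j _; rewrite integral_indic ?setIT//; exact: munhit.
  rewrite e1 e2; apply: nneg_le_integral => [w|w]; first by rewrite mule_ge0.
  rewrite sumEFin -!EFinM lee_fin -missedE indicE; case: (boolP (w \in _)) => h /=; last first.
    by rewrite mulr0 mulr_ge0.
  by move: h; rewrite inE /crowded/= mulr1 -natrM -natrX ler_nat mulnC => /ltnW.
have [Pf Pfin] : exists x, P (crowded m a p N L) = x%:E.
  by exists (fine (P (crowded m a p N L))); rewrite fineK// fin_num_measure//; exact: measurable_crowded.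
rewrite Pfin in step *; rewrite lee_fin.
have e3 : (\sum_(0 <= j < 2 ^ N) P (U m a N L j) =
    (\sum_(0 <= j < 2 ^ N) (1 - hitp (m + N) (a * 2 ^ N + j)) ^+ (L * 2 ^ N))%:E)%E.
  rewrite -sumEFin; apply: eq_bigr => j _; rewrite /U Punhit.
  by congr ((_ ^+ _)%:E); rewrite mulSn addKn.
rewrite e3 -!EFinM lee_fin in step.
rewrite -(ler_pM2l pN); apply: (le_trans step).
apply: (@le_trans _ _ (p.+2%:R * (kappa / p.+2%:R * 2 ^+ N))).
  by rewrite ler_wpM2l.
by rewrite mulrA mulrCA divff ?pnatr_eq0// mulr1 mulrC.
Qed.

(** With [L] chosen for the bound [1/(r+1)], the event of being crowded at all large scales is an
    increasing union of events of probability at most [1/(r+1)], so it obeys the same bound. Where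
    no [L] works, these events occur for every [r]. *)
Lemma crowded_ae m a p : (a < 2 ^ m)%N ->
  {ae P, forall w, exists L, forall n, exists2 N, (n <= N)%N & ~ crowded m a p N L w}.
Proof.
move=> am.
have /choice[Lr hLr] : forall r : nat, exists L, forall N,
    (P (crowded m a p N L) <= (r.+1%:R^-1)%:E)%E.
  by move=> r; apply: crowded_small; rewrite ?invr_gt0.
pose G r n := \bigcap_(N in [set N | (n <= N)%N]) crowded m a p N (Lr r).
have mG r n : measurable (G r n).
  by apply: bigcap_measurable => [|N _]; [exists n => /=|exact: measurable_crowded].
pose E r := \bigcup_n G r n.
have mE r : measurable (E r) by exact: bigcupT_measurable.
have PE r : (P (E r) <= (r.+1%:R^-1)%:E)%E.
  have cvg : (P \o G r) @ \oo --> P (E r).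
    apply: nondecreasing_cvg_mu; [exact: mG|exact: mE|].
    move=> n n' nn'; apply/subsetPset => w h N /= hN.
    by apply: h => /=; exact: leq_trans hN.
  rewrite -(cvg_lim _ cvg)//; apply: lime_le; first by apply/cvg_ex; eexists; exact: cvg.
  apply: nearW => n; apply: le_trans (hLr r n).
  by apply: le_measure; rewrite ?inE//; [exact: measurable_crowded|move=> w h; exact: (h n (leqnn n))].
exists (\bigcap_r E r); split.
- exact: bigcapT_measurable.
- apply/eqP; rewrite eq_le measure_ge0 andbT; apply/lee_addgt0Pr => e e0.
  have [r hr] := ex_nat_div_le 1 e0; rewrite add0e.
  apply: (@le_trans _ _ (P (E r))).
    by apply: le_measure; rewrite ?inE//; [exact: bigcapT_measurable|move=> w h; exact: h].
  by apply: (le_trans (PE r)); rewrite lee_fin -div1r.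
move=> w /= hw r _; apply: contrapT => hE; apply: hw; exists (Lr r) => n.
apply: contrapT => hn; apply: hE; exists n => // N /= nN.
by apply: contrapT => hc; apply: hn; exists N.
Qed.

Lemma well_spread_ae : {ae P, forall w, well_spread (c^~ w)}.
Proof.
have key m a p : {ae P, forall w, (a < 2 ^ m)%N -> exists L, forall n, exists2 N, (n <= N)%N &
    ~ crowded m a p N L w}.
  case: (ltnP a (2 ^ m)) => am; last by apply: aeW => w.
  by apply: filterS (crowded_ae p am) => w h _.
have := ae_foralln (fun m => ae_foralln (fun a => ae_foralln (fun p => key m a p))).
apply: filterS => w h m a p am; have [L hL] := h m a p am; exists L => n.
by have [N nN hN] := hL n; exists N => //; rewrite leqNgt; apply/negP.
Qed.

Lemma centers_ae : {ae P, forall w k, 0 <= c k w <= 1}.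
Proof.
apply: ae_foralln => k; exists (c k @^-1` (~` `[0%R, 1%R]%classic)); split.
- by apply: mpre; exact: measurableC.
- have m01 : measurable (~` `[0%R, 1%R]%classic : set R) by exact: measurableC.
  by apply: (etrans (law k m01)); rewrite setICl integral_set0.
- by move=> w /= h; rewrite in_itv.
Qed.

End HitProbability.

Unset Implicit Arguments.
Set Strict Implicit.

Theorem theorem1p2 (R : realType) (lambda : R) (d : measure_display)
    (Omega : measurableType d) (P : probability Omega R)
    (c : nat -> Omega -> R) (f : R -> R) :
  0 < lambda ->
  (forall k, measurable_fun setT (c k)) ->
  mutually_independent P c ->
  measurable_fun setT f ->
  (exists M : R, forall x, 0 <= f x <= M) ->
  {ae (@lebesgue_measure R), forall x, `[0, 1]%classic x -> 0 < f x} ->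
  (forall k (B : set R), measurable B ->
     P (c k @^-1` B) = (\int[lebesgue_measure]_(x in B `&` `[0%R, 1%R]%classic) (f x)%:E)%E) ->
  {ae P, forall w, Cap (real_axis (limsup_set lambda (fun k => c k w)))
                   = Cap (real_axis `[0, 1]%classic)}
  /\ (0 < Cap (real_axis (`[0%R, 1%R]%classic : set R)))%E.
Proof.
move=> lambda_gt0 mc indep mf [M fM] fpos law.
split; last exact: Cap_interval_gt0.
have f0 x : 0 <= f x by have /andP[] := fM x.
have spread := well_spread_ae mc indep mf f0 fpos law.
have centers := centers_ae mc law.
apply: filterS2 spread centers => w spread_w centers_w.
exact: Cap_limsup.
Qed.
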